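(* Let $\kappa>\omega$ be a cardinal with $\kappa^{<\kappa}=\kappa$. For every countable complete first-order theory $T$, the isomorphism relation $\cong_T$ is Borel reducible to $\cong_{RACG}$ (i.e. $\cong_T\ \leq_B\ \cong_{T_{racg}}$).
   Context: $T_{rg}$ is the first-order theory of the random graph. $T_{racg}$ is the complete first-order theory (in the language of groups) of any right-angled Coxeter group whose Coxeter graph is a model of $T_{rg}$ (a right-angled Coxeter group is a group with presentation: generators $S$, relations $s^2=e$ and $(ss')^2=e$ for some pairs of distinct $s,s'$; its Coxeter graph has vertex set $S$, with distinct $s,s'$ adjacent iff they commute); this theory does not depend on the choice of such group. Fix a countable relational language $L^*$ with countably many relation symbols of each arity; every countable first-order theory is regarded as an $L^*$-theory. Structures with universe $\kappa$ are coded in the standard way as elements $\eta(A)\in 2^\kappa$. $2^\kappa$ carries the topology generated by the sets $\{\eta:p\subseteq\eta\}$, $p\in 2^{<\kappa}$; Borel sets are the closure of open sets under complements and unions/intersections of size $\le\kappa$, and a function is Borel if preimages of open sets are Borel. For a complete theory $T$, $\cong_T=\{(\eta(A),\eta(B)):A,B\models T,\ A\cong B\}\cup\{(\eta(A),\eta(B)):A,B\not\models T\}$, and $\cong_{RACG}$ denotes $\cong_{T_{racg}}$. $E_0\le_B E_1$ means there is a Borel $F:2^\kappa\to2^\kappa$ with $\eta E_0\xi\iff F(\eta)E_1F(\xi)$. *)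

(* Defs.v *)
From HB Require Import structures.
From mathcomp Require Import all_boot all_order.
From mathcomp Require Import all_classical topology.

Set Implicit Arguments.
Unset Strict Implicit.
Unset Printing Implicit Defensive.

Import Order.TTheory.
Local Open Scope classical_set_scope.
Local Open Scope card_scope.

(** * First-order logic over relational languages *)

Record language := Language { symb : Type; arity : symb -> nat }.

(* Well-scoped de Bruijn syntax: [formula L n] has its free variables among
   'I_n, and [fAll] binds variable 0. *)
Inductive formula (L : language) : nat -> Type :=
| fFalse n : formula L n
| fEq n of 'I_n & 'I_n : formula L n
| fRel n (R : symb L) of (arity R).-tuple 'I_n : formula L n
| fImp n of formula L n & formula L n : formula L n
| fAll n of formula L n.+1 : formula L n.

Definition sentence (L : language) := formula L 0.
Definition theory (L : language) := set (sentence L).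

Record structure (L : language) := Structure {
  dom :> Type;
  interp : forall R : symb L, set ((arity R).-tuple dom) }.

Definition env_cons (M : Type) n (a : M) (v : 'I_n -> M) (i : 'I_n.+1) : M :=
  if unlift ord0 i is Some j then v j else a.

Fixpoint sat (L : language) (M : structure L) n (phi : formula L n) :
    ('I_n -> M) -> Prop :=
  match phi in formula _ n return ('I_n -> M) -> Prop with
  | fFalse _ => fun=> False
  | fEq _ i j => fun v => v i = v j
  | fRel _ R t => fun v => interp (map_tuple v t)
  | fImp _ p q => fun v => sat p v -> sat q v
  | fAll _ p => fun v => forall a : M, sat p (env_cons a v)
  end.

Definition empty_env (M : Type) (i : 'I_0) : M :=
  match notF (ltn_ord i) with end.

Definition holds (L : language) (M : structure L) (phi : sentence L) : Prop :=
  sat phi (@empty_env M).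

Definition models (L : language) (M : structure L) (T : theory L) : Prop :=
  forall phi, T phi -> holds M phi.

Definition theory_of (L : language) (M : structure L) : theory L :=
  [set phi | holds M phi].

(* As usual, only non-empty structures count as models of a theory; the
   structures with universe K and the models of T_rg are never empty. *)
Definition entails (L : language) (T : theory L) (phi : sentence L) : Prop :=
  forall M : structure L, inhabited M -> models M T -> holds M phi.

Definition fNot (L : language) n (phi : formula L n) : formula L n :=
  fImp phi (fFalse L n).

Definition complete_theory (L : language) (T : theory L) : Prop :=
  (exists2 M : structure L, inhabited M & models M T) /\
  (forall phi, entails T phi \/ entails T (fNot phi)).

Definition isomorphic (L : language) (M N : structure L) : Prop :=
  exists2 f : M -> N, bijective f &
    forall (R : symb L) (t : (arity R).-tuple M),
      interp t <-> interp (map_tuple f t).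

(* The symbol (n, i) is the i-th relation symbol of arity n. *)
Definition Lstar : language := @Language (nat * nat) fst.

(** * Graphs and the theory of the random graph *)

Definition Lgraph : language := @Language unit (fun=> 2).

Definition graph_structure (V : Type) (E : V -> V -> Prop) : structure Lgraph :=
  @Structure Lgraph V
    (fun _ => [set t | if tval t is [:: x; y] then E x y else False]).

(* The random graph in its presentation due to Ackermann and Rado: for i < j,
   the vertices i and j are adjacent iff the i-th binary digit of j is 1. *)
Definition rado_adj (i j : nat) : bool :=
  ((i < j) && odd (j %/ 2 ^ i)) || ((j < i) && odd (i %/ 2 ^ j)).

Lemma rado_adjC : symmetric rado_adj.
Proof. by move=> i j; rewrite /rado_adj orbC. Qed.

Lemma rado_adjxx : irreflexive rado_adj.
Proof. by move=> i; rewrite /rado_adj ltnn. Qed.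

Lemma exists_bits n (f : nat -> bool) :
  exists z, forall i, i < n -> odd (z %/ 2 ^ i) = f i.
Proof.
elim: n f => [|n IHn] f; first by exists 0.
have [z zP] := IHn (f \o S); exists (f 0 + z.*2) => -[_|i lt_in].
  by rewrite divn1 oddD odd_double addbF oddb.
by rewrite expnS divnMA divn2 half_bit_double zP.
Qed.

(* The extension property, which characterizes the random graph among the
   countable graphs up to isomorphism. *)
Lemma rado_extension (U V : seq nat) : ~~ has (mem U) V ->
  exists z, [/\ z \notin U ++ V, all (rado_adj z) U
              & ~~ has (rado_adj z) V].
Proof.
move=> UV0; pose N := (\max_(i <- U ++ V) i).+1.
have ltN i : i \in U ++ V -> i < N.
  by move=> iUV; rewrite ltnS; exact: (@leq_bigmax_seq _ _ predT id i iUV isT).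
have [z zP] := exists_bits N.+1 (fun i => (i == N) || (i \in U)).
have ltz i : i \in U ++ V -> i < z.
  move=> /ltN /ltn_trans; apply; apply: (leq_trans (ltn_expl N (ltnSn 1))).
  rewrite leqNgt; apply/negP => /divn_small z0.
  by have := zP N (ltnSn N); rewrite z0 eqxx.
have adjz i : i \in U ++ V -> rado_adj z i = (i \in U).
  move=> iUV; have lt_iN := ltN i iUV; have lt_iz := ltz i iUV.
  rewrite /rado_adj lt_iz [z < i]ltnNge (ltnW lt_iz) /=.
  by rewrite zP ?ltnS ?(ltnW lt_iN)// ltn_eqF.
exists z; split.
- by apply/negP => /ltz; rewrite ltnn.
- by apply/allP => i iU; rewrite adjz// mem_cat iU.
- apply: contra UV0 => /hasP[i iV]; rewrite adjz ?mem_cat ?iV ?orbT// => iU.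
  by apply/hasP; exists i.
Qed.

Definition T_rg : theory Lgraph := theory_of (graph_structure rado_adj).

(** * Presentations and right-angled Coxeter groups *)

(* (s, true) stands for the generator s, (s, false) for its inverse. *)
Definition word (S : Type) := seq (S * bool).

Inductive word_eq (S : Type) (rels : set (word S)) : word S -> word S -> Prop :=
| word_eq_refl w : word_eq rels w w
| word_eq_sym u v : word_eq rels u v -> word_eq rels v u
| word_eq_trans u v w :
    word_eq rels u v -> word_eq rels v w -> word_eq rels u w
| word_eq_cancel u s b v :
    word_eq rels (u ++ [:: (s, b); (s, ~~ b)] ++ v) (u ++ v)
| word_eq_rel u r v : rels r -> word_eq rels (u ++ r ++ v) (u ++ v).

Definition word_eval (W : groupType) (S : Type) (gen : S -> W) (w : word S) : W :=
  (\prod_(p <- w) (if p.2 then gen p.1 else (gen p.1)^-1))%g.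

(* W is the group with generators S, sent to W by gen, and relators rels. *)
Definition has_presentation (W : groupType) (S : Type) (gen : S -> W)
    (rels : set (word S)) : Prop :=
  (forall g : W, exists w, word_eval gen w = g) /\
  (forall u v, word_eval gen u = word_eval gen v <-> word_eq rels u v).

Definition racg_relators (S : Type) (P : S -> S -> Prop) : set (word S) :=
  [set r | (exists s, r = [:: (s, true); (s, true)]) \/
           (exists s s', [/\ s <> s', P s s' &
              r = [:: (s, true); (s', true); (s, true); (s', true)]])].

Definition is_racg (W : groupType) (S : Type) (gen : S -> W) : Prop :=
  exists P : S -> S -> Prop, has_presentation gen (racg_relators P).

Definition coxeter_graph (W : groupType) (S : Type) (gen : S -> W) :
    structure Lgraph :=
  graph_structure
    (fun s s' : S => s <> s' /\ (gen s * gen s' = gen s' * gen s)%g).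

(* A group as an L*-structure: the symbols (3, 0), (2, 0) and (1, 0) are the
   graphs of the product, the inverse and the unit; the other symbols are
   interpreted by the empty relation. *)
Definition group_structure (W : groupType) : structure Lstar :=
  @Structure Lstar W (fun R => [set t |
    match R.2, tval t with
    | 0, [:: x; y; z] => (x * y = z)%g
    | 0, [:: x; y] => (x^-1 = y)%g
    | 0, [:: x] => x = 1%g
    | _, _ => False
    end]).

(* T is the theory of some right-angled Coxeter group whose Coxeter graph is a
   model of T_rg.  There is only one such T, but this is a theorem. *)
Definition is_T_racg (T : theory Lstar) : Prop :=
  exists (W : groupType) (S : Type) (gen : S -> W),
    [/\ is_racg gen, models (coxeter_graph gen) T_rg &
        T = theory_of (group_structure W)].

(** * The generalized Cantor space *)

Definition segment d (K : orderType d) (a : K) : Type := {x : K | (x < a)%O}.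

(* A cardinal is an initial ordinal: a well-order that is not equinumerous to
   any of its proper initial segments. *)
Definition is_cardinal d (K : orderType d) : Prop :=
  well_founded (fun x y : K => (x < y)%O) /\
  (forall a : K, ~ ([set: K] #<= [set: segment a])).

(* Sequences of length < K with values in X. *)
Definition short_seq d (K : orderType d) (X : Type) : Type :=
  {a : K & segment a -> X}.

Definition gcantor d (K : orderType d) : Type := K -> bool.

Definition cylinder d (K : orderType d) (p : short_seq K bool) :
    set (gcantor K) :=
  [set eta | forall x : segment (projT1 p), eta (sval x) = projT2 p x].

HB.instance Definition _ d (K : orderType d) :=
  Choice.copy (gcantor K) (K -> bool).
(* The topology generated by the cylinders. *)
HB.instance Definition _ d (K : orderType d) :=
  isSubBaseTopological.Build (gcantor K) (range (@cylinder d K)) id.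

Inductive borel d (K : orderType d) : set (gcantor K) -> Prop :=
| borel_open U : open U -> borel U
| borel_setC A : borel A -> borel (~` A)
| borel_bigcup (F : K -> set (gcantor K)) :
    (forall i, borel (F i)) -> borel (\bigcup_i F i)
| borel_bigcap (F : K -> set (gcantor K)) :
    (forall i, borel (F i)) -> borel (\bigcap_i F i).

Definition borel_fun d (K : orderType d) (F : gcantor K -> gcantor K) : Prop :=
  forall U : set (gcantor K), open U -> borel (F @^-1` U).

Definition borel_reducible d (K : orderType d)
    (E0 E1 : gcantor K -> gcantor K -> Prop) : Prop :=
  exists2 F : gcantor K -> gcantor K, borel_fun F &
    forall eta xi, E0 eta xi <-> E1 (F eta) (F xi).

(** * Coding of structures with universe K *)

Definition interpretation (L : language) (X : Type) : Type :=
  forall R : symb L, set ((arity R).-tuple X).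

Definition atom (X : Type) : Type := {R : symb Lstar & (arity R).-tuple X}.

Definition eta_code d (K : orderType d) (code : atom K -> K)
    (A : interpretation Lstar K) : gcantor K :=
  fun a => `[< exists (R : symb Lstar) (t : (arity R).-tuple K),
                 a = code (existT _ R t) /\ A R t >].

Definition iso_rel d (K : orderType d) (code : atom K -> K) (T : theory Lstar)
    (eta xi : gcantor K) : Prop :=
  exists A B : interpretation Lstar K,
    [/\ eta = eta_code code A, xi = eta_code code B &
        [/\ models (Structure A) T, models (Structure B) T &
            isomorphic (Structure A) (Structure B)] \/
        (~ models (Structure A) T /\ ~ models (Structure B) T)].

(* Main.v *)
Require Import Defs.
From HB Require Import structures.
From mathcomp Require Import all_boot all_order finmap.
From mathcomp Require Import all_classical topology.
From Stdlib Require Import ZArith Lia.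

(** A structure A with universe K is coded into a graph on a fixed set of
   vertices as follows.  The incidence graph of the atoms of A, with vertices
   labelled by pendant vertices, is joined to an independent set of size K; to
   this core one adds freely, for every finite set U of vertices, infinitely
   many vertices adjacent to exactly U, which yields the extension property.
   The core is recovered as the union of the complete bipartite subgraphs with
   two uncountable sides, because the added vertices have finitely many
   neighbours below them.

   The right-angled Coxeter group W of a graph with the extension property
   determines the graph.  If s and t are not adjacent, W maps onto the infinite
   dihedral group <s, t>, where an element with odd exponents in s and in t has
   infinite order; so the images of the involutions in the abelianization of W
   are the finite cliques, among which the singletons are recognized by a
   maximality property.

   The theory of W does not depend on the graph: finite partial isomorphisms of
   graphs with the extension property form a back-and-forth system, and they
   induce one on words since special subgroups are retracts.

   Finally W is transported to the universe K by an explicit Cantor-Bernstein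
   bijection.  All the constructions only quantify over sets of size at most K,
   hence they are Borel. *)

Set Implicit Arguments.
Unset Strict Implicit.
Unset Printing Implicit Defensive.

Import Order.TTheory.
Local Open Scope classical_set_scope.
Local Open Scope card_scope.

(** * Words of right-angled Coxeter groups *)

Lemma word_eq_cat2 (S : Type) (rels : set (word S)) w w' u v :
  word_eq rels u v -> word_eq rels (w ++ u ++ w') (w ++ v ++ w').
Proof.
elim=> {u v} [u|u v _ IH|u v x _ IHu _ IHv|u s b v|u r v rP].
- exact: word_eq_refl.
- exact: word_eq_sym.
- exact: word_eq_trans IHu IHv.
- by rewrite -!catA catA [w ++ (u ++ _)]catA; exact: word_eq_cancel.
- by rewrite -!catA catA [w ++ (u ++ _)]catA; exact: word_eq_rel.
Qed.

Lemma word_eq_cat (S : Type) (rels : set (word S)) u u' v v' :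
  word_eq rels u u' -> word_eq rels v v' -> word_eq rels (u ++ v) (u' ++ v').
Proof.
move=> uu' vv'; apply: (@word_eq_trans _ _ _ (u' ++ v)).
  exact: (word_eq_cat2 [::] v uu').
by have := word_eq_cat2 u' [::] vv'; rewrite !cats0.
Qed.

Lemma word_eq_sub (S : Type) (rels rels' : set (word S)) u v :
  (forall r, rels r -> word_eq rels' r [::]) ->
  word_eq rels u v -> word_eq rels' u v.
Proof.
move=> sub; elim=> {u v} [u|u v _ IH|u v x _ IHu _ IHv|u s b v|u r v rP].
- exact: word_eq_refl.
- exact: word_eq_sym.
- exact: word_eq_trans IHu IHv.
- exact: word_eq_cancel.
- by have := word_eq_cat2 u v (sub r rP).
Qed.

Notation racg_eq P := (word_eq (racg_relators P)).

Section RacgWords.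
Variables (S : eqType) (P : S -> S -> Prop).
Hypothesis P_sym : forall s t, P s t -> P t s.
Implicit Types (s t z : S) (u v w k : word S).
Local Notation "u =W v" := (racg_eq P u v) (at level 70).
Local Notation letter s := [:: (s, true)].

(** Every generator is an involution, so it coincides with its formal inverse and the signs of
    letters can be ignored modulo the relators. *)
Lemma racg_eq_square s b b' : [:: (s, b); (s, b')] =W [::].
Proof.
case: b b' => -[]; try exact: (word_eq_cancel _ [::] s _ [::]).
  by apply: (@word_eq_rel _ _ [::] [:: _; _] [::]); left; exists s.
have rss : [:: (s, true); (s, true)] =W [::].
  by apply: (@word_eq_rel _ _ [::] [:: _; _] [::]); left; exists s.
(* Both letters are inverses: [s s] is inserted between them, and two cancellations follow. *)
apply: (@word_eq_trans _ _ _ [:: (s, false); (s, true); (s, true); (s, false)]).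
  exact/word_eq_sym/(word_eq_cat2 [:: _] [:: _] rss).
apply: (@word_eq_trans _ _ _ [:: (s, true); (s, false)]).
  exact: (word_eq_cancel _ [::] s false _).
exact: (word_eq_cancel _ [::] s true [::]).
Qed.

Lemma racg_eq_comm s t : s <> t -> P s t ->
  [:: (s, true); (t, true)] =W [:: (t, true); (s, true)].
Proof.
move=> st Pst; apply: word_eq_sym.
pose r := [:: (s, true); (t, true); (s, true); (t, true)].
apply: (@word_eq_trans _ _ _ (r ++ [:: (t, true); (s, true)])).
  apply/word_eq_sym/(@word_eq_rel _ _ [::] r).
  by right; exists s, t.
apply: (@word_eq_trans _ _ _ [:: (s, true); (t, true); (s, true); (s, true)]).
  exact: (word_eq_cat2 [:: _; _; _] [:: _] (racg_eq_square t true true)).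
exact: (word_eq_cat2 [:: _; _] [::] (racg_eq_square s true true)).
Qed.

(** These parities are the coordinates of [u] in the abelianization, a direct sum of copies of Z/2
    indexed by [S]. *)
Definition par s u := odd (count (fun p => p.1 == s) u).

Lemma par_cat s u v : par s (u ++ v) = par s u (+) par s v.
Proof. by rewrite /par count_cat oddD. Qed.

Lemma par_cons s p u : par s (p :: u) = (p.1 == s) (+) par s u.
Proof. by rewrite /par /= oddD oddb. Qed.

Lemma par_letter s t : par s (letter t) = (t == s).
Proof. by rewrite /par /= addn0 oddb. Qed.

Lemma par_eq s u v : u =W v -> par s u = par s v.
Proof.
elim=> {u v} [//|//|u v x _ -> _ ->//|u t b v|u r v].
  by rewrite !par_cat !par_cons /=; case: (t == s) (par s u) (par s v) => -[] [].
move=> [[t ->]|[t [t' [_ _ ->]]]]; rewrite !par_cat !par_cons.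
  by rewrite /=; case: (t == s) (par s u) (par s v) => -[] [].
by rewrite /=; case: (t == s) (t' == s) (par s u) (par s v) => -[] [] [].
Qed.

Definition clique (c : pred S) := forall s t, c s -> c t -> s <> t -> P s t.

(* For non-adjacent [s] and [t], [refl s t] is the action of W on the integers
   through its retraction onto the infinite dihedral group <s, t>. *)
Definition refl1 s t (x : S) (a : Z) : Z :=
  if x == s then (- a)%Z else if x == t then (- a + 1)%Z else a.

Definition refl s t u a := foldr (fun p => refl1 s t p.1) a u.

Lemma refl_cat s t u v a : refl s t (u ++ v) a = refl s t u (refl s t v a).
Proof. exact: foldr_cat. Qed.

Lemma refl1K s t x : involutive (refl1 s t x).
Proof.
by move=> a; rewrite /refl1; case: (x =P s) => _; last case: (x =P t) => _; lia.
Qed.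

Lemma refl_eq s t u v : s <> t -> ~ P s t -> u =W v ->
  forall a, refl s t u a = refl s t v a.
Proof.
move=> st Pst; elim=> {u v} [//|u v _ IH a|u v x _ IH _ IH' a|u x b v a|u r v].
- by rewrite IH.
- by rewrite IH IH'.
- by rewrite !refl_cat; congr refl; exact: refl1K.
move=> rP a; rewrite !refl_cat; congr refl; case: rP => [[x ->]|].
  exact: refl1K.
move=> [x [y [xy Pxy ->]]]; rewrite /= /refl1.
case: (x =P s) => [xs|xs]; case: (y =P s) => [ys|ys].
- by case: xy; rewrite xs ys.
- case: (y =P t) => [yt|yt]; last by rewrite Z.opp_involutive.
  by case: Pst; rewrite -xs -yt.
- case: (x =P t) => [xt|xt]; last by rewrite Z.opp_involutive.
  by case: Pst; apply: P_sym; rewrite -xt -ys.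
- case: (x =P t) => [xt|xt]; case: (y =P t) => [yt|yt]; lia.
Qed.

(** Both generators act by reflections, and only that of [t] also shifts by one. Hence the two
    parities determine the linear part and the translation part modulo 2. *)
Lemma reflE s t u : s <> t -> exists k : Z, forall a : Z, refl s t u a =
  ((if par s u (+) par t u then - a else a) +
   (if par t u then 1 else 0) + (k + k))%Z.
Proof.
move=> st; elim: u => [|[x b] u [k IH]]; first by exists 0%Z => a /=; lia.
rewrite !par_cons /=; rewrite /refl1.
case: (x =P s) => [->|xs].
  have /eqP/negPf -> := st.
  exists (- k - (if par t u then 1 else 0))%Z => a; rewrite IH.
  by case: (par s u) (par t u) => -[] /=; lia.
case: (x =P t) => [xt|xt]; last by exists k.
exists (- k)%Z => a; rewrite IH.
by case: (par s u) (par t u) => -[] /=; lia.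
Qed.

(** If non-adjacent [s] and [t] both had odd parity, [u] would act on the integers as a translation
    by an odd number, and [u ++ u] as a nonzero translation. *)
Lemma involution_clique u : u ++ u =W [::] -> clique (par^~ u).
Proof.
move=> uu s t us ut st; apply: contrapT => Pst.
have := refl_eq st Pst uu 0; rewrite refl_cat.
have [k] := reflE u st; rewrite us ut -[true (+) true]/false => E.
have -> : refl s t [::] 0 = 0%Z by [].
by rewrite !E; lia.
Qed.

Lemma uniq_clique_word (c : seq S) : uniq c -> clique (mem c) ->
  exists2 u, u ++ u =W [::] & forall s, par s u = (s \in c).
Proof.
move=> uc cc; exists [seq (s, true) | s <- c]; last first.
  move=> s; rewrite /par count_map.
  have -> : count (preim (fun s => (s, true)) (fun p => p.1 == s)) c =
            count_mem s c by apply: eq_count => x /=; rewrite eq_sym.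
  by rewrite count_uniq_mem// oddb.
elim: c uc cc => [|s c IH] /=; first by move=> *; exact: word_eq_refl.
move=> /andP[sc uc] cc; set w := map _ c.
have {}IH : w ++ w =W [::].
  by apply: IH => // x y xc yc; apply: cc; rewrite /= inE; apply/orP; right.
(* The letter [s] moves through [w] one letter at a time, since it is adjacent to all of them. *)
have sw : (s, true) :: w =W w ++ letter s.
  rewrite /w; have {}cc x : x \in c -> s <> x /\ P s x.
    move=> xc; have sx : s <> x by move=> sx; rewrite sx xc in sc.
    by split=> //; apply: cc => //=; rewrite inE ?eqxx ?xc ?orbT.
  elim: c cc {sc uc IH w} => [|x c IH] cc; first exact: word_eq_refl.
  have [sx Psx] := cc x (mem_head _ _).
  apply: (@word_eq_trans _ _ _ ([:: (x, true); (s, true)] ++ map (pair^~ true) c)).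
    exact: (word_eq_cat2 [::] _ (racg_eq_comm sx Psx)).
  apply: (word_eq_cat (word_eq_refl _ (letter x))); apply: IH => y yc.
  by apply: cc; rewrite inE yc orbT.
apply: (@word_eq_trans _ _ _ (((s, true) :: w) ++ letter s ++ w)).
  by rewrite /=; exact: word_eq_refl.
apply: (@word_eq_trans _ _ _ ((w ++ letter s) ++ letter s ++ w)).
  exact: (word_eq_cat2 [::] _ sw).
rewrite -catA; apply: (@word_eq_trans _ _ _ (w ++ w)) => //.
exact: (word_eq_cat2 w w (racg_eq_square s true true)).
Qed.

(** Converse of [involution_clique] for finite cliques; the list [l] serves to bound the clique. *)
Lemma clique_word (c : pred S) (l : seq S) : clique c ->
  (forall s, c s -> s \in l) ->
  exists2 u, u ++ u =W [::] & forall s, par s u = c s.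
Proof.
move=> cc cl; have [||u uu uP] := @uniq_clique_word [seq s <- undup l | c s].
- exact/filter_uniq/undup_uniq.
- by move=> s t /=; rewrite !mem_filter => /andP[? _] /andP[? _]; apply: cc.
exists u => // s; rewrite uP mem_filter mem_undup.
by case cs: (c s) => //=; rewrite cl.
Qed.

Lemma par_mem s u : par s u -> s \in [seq p.1 | p <- u].
Proof.
by move=> us; rewrite -has_pred1 has_map has_count; move: us; rewrite /par; case: count.
Qed.

(** Every homomorphism to Z/2 factors through the parities: the first letter of an even word occurs
    again, and deleting both occurrences does not change [chi]. This is what lets group
    isomorphisms, which need not send letters to letters, respect parities. *)
Lemma even_hom (chi : word S -> bool) u :
  (forall v w, v =W w -> chi v = chi w) ->
  (forall v w, chi (v ++ w) = chi v (+) chi w) ->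
  (forall s, par s u = false) -> chi u = false.
Proof.
move=> chi_eq chiM; have chi0 : chi [::] = false.
  by have := chiM [::] [::]; case: (chi [::]).
have chib s b b' : chi [:: (s, b)] = chi [:: (s, b')].
  have := chi_eq _ _ (racg_eq_square s b b').
  by rewrite chi0 -cat1s chiM; case: (chi _) (chi _) => -[].
have [n] := ubnP (size u); elim: n u => // n IH [//|[s b] u] /= ltu u0.
have us : par s u by have := u0 s; rewrite par_cons eqxx /= => /negbFE.
have /mapP[[s' b'] pu /= s's] := par_mem us; subst s'.
have [u1 [u2 uE]] : exists u1 u2, u = u1 ++ (s, b') :: u2.
  by case/splitPr: pu => u1 u2; exists u1, u2.
have -> : chi ((s, b) :: u) = chi (u1 ++ u2).
  rewrite uE (chiM [:: _]) !chiM (chiM [:: _] u2) (chib s b b').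
  by case: (chi _) (chi _) (chi _) => -[] [].
apply: IH => [|x].
  by move: ltu; rewrite uE !size_cat /= addnS => /ltnW.
have := u0 x; rewrite uE par_cons !par_cat par_cons /= => <-.
by case: (s == x) (par x u1) (par x u2) => -[] [].
Qed.

Definition same_par u v := forall s, par s u = par s v.

Lemma same_par_hom (chi : word S -> bool) u v :
  (forall v w, v =W w -> chi v = chi w) ->
  (forall v w, chi (v ++ w) = chi v (+) chi w) ->
  same_par u v -> chi u = chi v.
Proof.
move=> chi_eq chiM uv; have {}uv s : par s (u ++ v) = false by rewrite par_cat uv addbb.
by have := even_hom chi_eq chiM uv; rewrite chiM; case: (chi u) (chi v) => -[].
Qed.

Definition perp u v := exists2 w, w ++ w =W [::] & same_par w (u ++ v).

(* Modulo parity, the involutions are the finite cliques, and [perp] says that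
   the union of two cliques is a clique; in a graph with the extension property
   the singletons are the non-empty cliques with a maximal set of [perp]s. *)
Definition vertex_like u := [/\ u ++ u =W [::], ~ same_par u [::] &
  forall v, v ++ v =W [::] -> ~ same_par v [::] ->
    (forall k, k ++ k =W [::] -> perp u k -> perp v k) -> same_par v u].

Definition extension_property := forall U V : seq S,
  (forall x, x \in U -> x \notin V) ->
  exists z, [/\ z \notin U ++ V, forall x, x \in U -> P z x
              & forall x, x \in V -> ~ P z x].

Lemma letter_involution s : letter s ++ letter s =W [::].
Proof. exact: racg_eq_square. Qed.

Lemma letter_nontrivial s : ~ same_par (letter s) [::].
Proof. by move=> /(_ s); rewrite par_letter eqxx. Qed.

Lemma same_par_letter_inj s t : same_par (letter s) (letter t) -> s = t.
Proof. by move=> /(_ s); rewrite !par_letter eqxx => /esym/eqP. Qed.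

Lemma same_parS u v : same_par u v -> same_par v u.
Proof. by move=> uv s; rewrite uv. Qed.

Lemma same_par_trans v u w : same_par u v -> same_par v w -> same_par u w.
Proof. by move=> uv vw s; rewrite uv. Qed.

Lemma perp_same_par u u' v v' :
  same_par u u' -> same_par v v' -> perp u v -> perp u' v'.
Proof.
by move=> uu' vv' [w ww wP]; exists w => // s; rewrite wP !par_cat uu' vv'.
Qed.

Lemma perp_letter s t : s <> t -> perp (letter s) (letter t) <-> P s t.
Proof.
move=> st; split=> [[w ww wP]|Pst].
  apply: (involution_clique ww) => //; rewrite wP par_cat !par_letter eqxx.
    by case: eqP st => // ->.
  by case: eqP st.
have cc : clique (fun x => (x == s) || (x == t)).
  move=> x y /orP[]/eqP-> /orP[]/eqP-> // _; exact: P_sym.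
have [x|u uu uP] := clique_word (l := [:: s; t]) cc; first by rewrite !inE.
exists u => // x; rewrite uP par_cat !par_letter !(eq_sym x).
by case: (s =P x) => [sx|_]; case: (t =P x) => [tx|_] //; case: st; rewrite sx.
Qed.

Hypothesis P_ext : extension_property.

(** If the clique of a competitor [v] contained some [t] other than [s], the extension property
    would give [z] adjacent to [s] and not to [t]. The letter [z] is then a perp of [u] but cannot
    be a perp of [v]. *)
Lemma vertex_like_letter u s :
  u ++ u =W [::] -> same_par u (letter s) -> vertex_like u.
Proof.
move=> uu us; split=> //.
  by move=> u0; apply: (@letter_nontrivial s); apply/(same_par_trans _ u0)/same_parS.
move=> v vv v0 vP; have cv := involution_clique vv.
have vs t : par t v -> t = s.
  move=> vt; apply: contrapT => ts.
  have [|z] := P_ext (U := [:: s]) (V := [:: t]).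
    by move=> x; rewrite !inE => /eqP->; apply/eqP/nesym.
  rewrite !inE !negb_or => -[/andP[/eqP zs /eqP zt] Pzs Pzt].
  have {}Pzs := Pzs s (mem_head _ _); have {}Pzt := Pzt t (mem_head _ _).
  have [|w ww wP] := vP _ (letter_involution z).
    apply: (perp_same_par (same_parS us) (fun=> erefl)).
    by apply/perp_letter; [exact: nesym|exact: P_sym].
  have wt : par t w.
    by rewrite wP par_cat vt par_letter; case: eqP zt.
  (* If [z] lies in the clique of [v], it cancels in the sum, but then [v] itself makes it adjacent
     to [t]. *)
  apply: Pzt; case vz: (par z v); first exact: cv.
  apply: (involution_clique ww) => //.
  by rewrite wP par_cat vz par_letter eqxx.
have vss : par s v.
  apply: contrapT => /negP vs'; apply: v0 => t; apply/negbTE.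
  by apply: contra vs' => vt; rewrite -(vs t vt).
move=> t; rewrite us par_letter; apply/idP/eqP => [/vs->//|<-//].
Qed.

(** Any vertex [s] of the clique of [u] has all the perps of [u], so the maximality of [u], applied
    to the letter [s], identifies the two. *)
Lemma vertex_likeP u : vertex_like u -> exists s, same_par u (letter s).
Proof.
move=> [uu u0 uP]; have [s us] : exists s, par s u.
  apply: contrapT => nus; apply: u0 => s; apply/negbTE/negP => us.
  by apply: nus; exists s.
exists s; apply/same_parS/uP; first exact: letter_involution.
  exact: letter_nontrivial.
move=> k kk [w ww wP].
have cu := involution_clique uu; have ck := involution_clique kk.
have cw := involution_clique ww.
have [|x|v vv vP] := @clique_word (fun x => (x == s) (+) par x k)
  (s :: [seq p.1 | p <- k]).
(* A vertex that cancels in [u ++ k] lies in both cliques, and one of these then supplies the edge;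
   otherwise both ends survive in [w]. *)
- have ckt t : par t k -> s <> t -> P s t.
    move=> kt st; case ut: (par t u); first exact: cu.
    case ks: (par s k); first exact: ck.
    by apply: cw => //; rewrite wP par_cat ?us ?ks ?ut ?kt.
  move=> x y; case: (x =P s) => [->|_]; case: (y =P s) => [->|_] //=.
  + by move=> _ ky ys; apply: ckt.
  + by move=> kx _ xs; apply: P_sym; apply: ckt => // /esym.
  + exact: ck.
- by rewrite inE; case: eqP => //= _ /par_mem.
exists v => // x; rewrite vP par_cat par_letter eq_sym //.
Qed.

End RacgWords.

(** * Structures presented by words *)

(** The unit, inverse and product relations read on words. The inverse is expressed by a product
    equal to the empty word, so that only concatenation and [racg_eq] occur. *)
Definition racg_atom (S : Type) (P : S -> S -> Prop) (i : nat)
    (us : seq (word S)) : Prop :=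
  match i, us with
  | 0, [:: u; v; w] => racg_eq P (u ++ v) w
  | 0, [:: u; v] => racg_eq P (u ++ v) [::]
  | 0, [:: u] => racg_eq P u [::]
  | _, _ => False
  end.

(** This says that [M] is the right-angled Coxeter group of [P] without requiring a [groupType], so
    that it applies both to [group_structure W] and to structures with universe [K]. *)
Definition presented (S : Type) (P : S -> S -> Prop) (M : structure Lstar)
    (ev : word S -> M) : Prop :=
  [/\ forall a, exists u, ev u = a,
      forall u v, ev u = ev v <-> racg_eq P u v &
      forall (R : symb Lstar) (t : (arity R).-tuple M),
        interp t <-> exists us, map ev us = tval t /\ racg_atom P R.2 us].

Lemma racg_atom_eq (S : Type) (P : S -> S -> Prop) (X : Type)
    (ev : word S -> X) i us vs :
  (forall u v, ev u = ev v <-> racg_eq P u v) ->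
  map ev us = map ev vs -> racg_atom P i us -> racg_atom P i vs.
Proof.
move=> evP; case: i => // ; case: us => [|u [|u' [|u'' [|? ?]]]] //;
  case: vs => [|v [|v' [|v'' [|? ?]]]] //=.
- by move=> [/evP uv] uP; exact: word_eq_trans (word_eq_sym uv) uP.
- move=> [/evP uv /evP uv'] uP; apply: word_eq_trans uP.
  exact: word_eq_cat (word_eq_sym uv) (word_eq_sym uv').
- move=> [/evP uv /evP uv' /evP uv''] uP; apply: word_eq_trans uv''.
  apply: word_eq_trans uP.
  exact: word_eq_cat (word_eq_sym uv) (word_eq_sym uv').
Qed.

Lemma interp_words (S : Type) (P : S -> S -> Prop) (M : structure Lstar)
    (ev : word S -> M) (R : symb Lstar) (t : (arity R).-tuple M) us :
  presented P ev -> tval t = map ev us -> interp t <-> racg_atom P R.2 us.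
Proof.
move=> [_ evP evI] tE; split=> [/evI[vs [vsE]]|uP].
  by apply: racg_atom_eq; [exact: evP|rewrite vsE].
by apply/evI; exists us.
Qed.

(** * Homomorphisms induced by maps between generators *)

Section MapWord.
Variables (S S' : Type) (P : S -> S -> Prop) (P' : S' -> S' -> Prop).

Definition map_word (f : S -> S') (u : word S) : word S' :=
  [seq (f p.1, p.2) | p <- u].

Lemma map_word_cat f u v : map_word f (u ++ v) = map_word f u ++ map_word f v.
Proof. exact: map_cat. Qed.

(** Letters outside the domain of [f] are deleted, as in the retraction of the group onto a special
    subgroup. *)
Definition pmap_word (f : S -> option S') (u : word S) : word S' :=
  pmap (fun p => omap (pair^~ p.2) (f p.1)) u.

Lemma pmap_word_cat f u v :
  pmap_word f (u ++ v) = pmap_word f u ++ pmap_word f v.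
Proof. exact: pmap_cat. Qed.

(** Depending on how many of its two generators survive, a commutation relator becomes a commutation
    relator, a square or the empty word. *)
Lemma pmap_word_eq (f : S -> option S') u v :
  (forall s t x, f s = Some x -> f t = Some x -> s = t) ->
  (forall s t x y, s <> t -> P s t -> f s = Some x -> f t = Some y -> P' x y) ->
  racg_eq P u v -> racg_eq P' (pmap_word f u) (pmap_word f v).
Proof.
move=> f_inj fP; elim=> {u v} [u|u v _ IH|u v x _ IHu _ IHv|u s b v|u r v rP].
- exact: word_eq_refl.
- exact: word_eq_sym.
- exact: word_eq_trans IHu IHv.
- rewrite !pmap_word_cat /=; case: (f s) => [x|] /=; last exact: word_eq_refl.
  exact: word_eq_cancel.
suff : racg_eq P' (pmap_word f r) [::].
  by move=> /(word_eq_cat2 (pmap_word f u) (pmap_word f v)); rewrite !pmap_word_cat.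
case: rP => [[s ->]|[s [t [st Pst ->]]]] /=.
  case: (f s) => [x|] /=; last exact: word_eq_refl.
  by apply: (@word_eq_rel _ _ [::] [:: _; _] [::]); left; exists x.
case fs: (f s) => [x|]; case ft: (f t) => [y|] /=.
- apply: (@word_eq_rel _ _ [::] [:: _; _; _; _] [::]); right; exists x, y.
  split=> //; last exact: fP fs ft.
  by move=> xy; apply: st; apply: f_inj fs _; rewrite xy.
- by apply: (@word_eq_rel _ _ [::] [:: _; _] [::]); left; exists x.
- by apply: (@word_eq_rel _ _ [::] [:: _; _] [::]); left; exists y.
- exact: word_eq_refl.
Qed.

Lemma map_word_eq (f : S -> S') u v : injective f ->
  (forall s t, P s t -> P' (f s) (f t)) ->
  racg_eq P u v -> racg_eq P' (map_word f u) (map_word f v).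
Proof.
move=> f_inj fP uv; have E w : map_word f w = pmap_word (Some \o f) w.
  by elim: w => //= p w <-.
rewrite !E; apply: pmap_word_eq uv.
  by move=> s t x [<-] [/f_inj].
by move=> s t x y _ Pst [<-] [<-]; exact: fP.
Qed.

End MapWord.

Lemma map_wordK (S S' : Type) (f : S -> S') (g : S' -> S) :
  cancel f g -> cancel (map_word f) (map_word g).
Proof. by move=> fK; elim=> //= -[s b] u -> /=; rewrite fK. Qed.

Lemma racg_atom_map (S S' : Type) (P : S -> S -> Prop) (P' : S' -> S' -> Prop)
    (f : word S -> word S') i us :
  (forall u v, f (u ++ v) = f u ++ f v) -> f [::] = [::] ->
  (forall u v, racg_eq P u v -> racg_eq P' (f u) (f v)) ->
  racg_atom P i us -> racg_atom P' i (map f us).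
Proof.
move=> fM f0 feq; case: i => //; case: us => [|u [|v [|w [|? ?]]]] //= /feq;
  by rewrite ?fM ?f0.
Qed.

Definition graph_iso (S S' : Type) (P : S -> S -> Prop) (P' : S' -> S' -> Prop)
    (f : S -> S') (g : S' -> S) : Prop :=
  [/\ cancel f g, cancel g f, forall s t, P s t -> P' (f s) (f t)
    & forall s t, P' s t -> P (g s) (g t)].

Lemma graph_iso_sym (S S' : Type) (P : S -> S -> Prop) (P' : S' -> S' -> Prop)
    (f : S -> S') (g : S' -> S) : graph_iso P P' f g -> graph_iso P' P g f.
Proof. by case. Qed.

Lemma graph_iso_presented (S S' : Type) (P : S -> S -> Prop)
    (P' : S' -> S' -> Prop) (M M' : structure Lstar) (ev : word S -> M)
    (ev' : word S' -> M') f g :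
  presented P ev -> presented P' ev' -> graph_iso P P' f g -> isomorphic M M'.
Proof.
move=> pM pM' [fK gK fP gP].
have [surj evP _] := pM; have [surj' evP' _] := pM'.
have [w wE] := choice surj; have [w' wE'] := choice surj'.
pose F a := ev' (map_word f (w a)); pose G b := ev (map_word g (w' b)).
have evF u : F (ev u) = ev' (map_word f u).
  by apply/evP'/(map_word_eq (can_inj fK) fP)/evP; rewrite wE.
have evG u : G (ev' u) = ev (map_word g u).
  by apply/evP/(map_word_eq (can_inj gK) gP)/evP'; rewrite wE'.
exists F.
  exists G => a; [rewrite -(wE a)|rewrite -(wE' a)]; rewrite (evF, evG) (evF, evG).
    by rewrite map_wordK.
  by rewrite map_wordK.
move=> R t; pose us := map w t.
have tE : tval t = map ev us.
  by rewrite -map_comp -[LHS]map_id; apply: eq_map => a /=; rewrite wE.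
have tE' : tval (map_tuple F t) = map ev' (map (map_word f) us).
  by rewrite /= tE -!map_comp; apply: eq_map => u /=; rewrite evF.
rewrite (interp_words pM tE) (interp_words pM' tE'); split.
  apply: racg_atom_map => // [|u v]; first exact: map_word_cat.
  by apply: map_word_eq => //; exact: can_inj fK.
move=> /(racg_atom_map (f := map_word g) (P' := P)).
rewrite (mapK (map_wordK fK)); apply => // [|u v]; first exact: map_word_cat.
by apply: map_word_eq => //; exact: can_inj gK.
Qed.

(** * Rigidity *)

Section WordIso.
Variables (S S' : eqType) (P : S -> S -> Prop) (P' : S' -> S' -> Prop).

(** A homomorphism of groups lifted to words, with a left inverse. The lift depends on choices of
    words, so all equations hold modulo the relators; an isomorphism is a pair of such records. *)
Record word_iso (f : word S -> word S') (g : word S' -> word S) : Prop := WordIso {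
  word_iso_eq : forall u v, racg_eq P u v -> racg_eq P' (f u) (f v);
  word_iso_cat : forall u v, racg_eq P' (f (u ++ v)) (f u ++ f v);
  word_iso_nil : racg_eq P' (f [::]) [::];
  word_isoK : forall u, racg_eq P (g (f u)) u }.

Variables (f : word S -> word S') (g : word S' -> word S).
Hypothesis fP : word_iso f g.

Lemma word_iso_involution u :
  racg_eq P (u ++ u) [::] -> racg_eq P' (f u ++ f u) [::].
Proof.
move=> uu; apply: word_eq_trans (word_iso_nil fP).
by apply: word_eq_trans (word_iso_eq fP uu); exact: word_eq_sym (word_iso_cat fP _ _).
Qed.

(** A parity of [f w] is a homomorphism to Z/2 in [w], hence determined by the parities of [w]: [f]
    induces a map of abelianizations. *)
Lemma word_iso_same_par u v : same_par u v -> same_par (f u) (f v).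
Proof.
move=> uv s; pose chi w := par s (f w).
apply: (@same_par_hom _ P chi) => // x y.
  by move=> xy; exact: par_eq (word_iso_eq fP xy).
by rewrite /chi -par_cat; exact: par_eq (word_iso_cat fP _ _).
Qed.

Lemma word_iso_perp u v : perp P u v -> perp P' (f u) (f v).
Proof.
move=> [w ww wP]; exists (f w); first exact: word_iso_involution.
apply: (same_par_trans (word_iso_same_par wP)) => s.
exact: par_eq (word_iso_cat fP _ _).
Qed.

End WordIso.

Section Rigidity.
Variables (S S' : eqType) (P : S -> S -> Prop) (P' : S' -> S' -> Prop).
Hypothesis P_sym : forall s t, P s t -> P t s.
Hypothesis P_sym' : forall s t, P' s t -> P' t s.
Hypothesis P_ext : extension_property P.
Hypothesis P_ext' : extension_property P'.

(** The property is phrased by concatenation, relations and [same_par] alone, all of which [f] and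
    [g] transport; competitors are pulled back along [g]. *)
Lemma word_iso_vertex_like f g u : word_iso P P' f g -> word_iso P' P g f ->
  vertex_like P u -> vertex_like P' (f u).
Proof.
move=> fP gP [uu u0 uP].
have gf v : same_par (g (f v)) v by move=> s; exact: par_eq (word_isoK fP v).
have fg v : same_par (f (g v)) v by move=> s; exact: par_eq (word_isoK gP v).
split; first exact: (word_iso_involution fP).
  move=> fu0; apply: u0; apply: same_par_trans (same_parS (gf u)) _.
  apply: same_par_trans (word_iso_same_par gP fu0) _ => s.
  exact: par_eq (word_iso_nil gP).
move=> v vv v0 vP; apply: same_par_trans (same_parS (fg v)) _.
apply: (word_iso_same_par fP); apply: uP; first exact: (word_iso_involution gP).
  move=> gv0; apply: v0; apply: same_par_trans (same_parS (fg v)) _.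
  apply: same_par_trans (word_iso_same_par fP gv0) _ => s.
  exact: par_eq (word_iso_nil fP).
move=> k kk uk; apply: perp_same_par (fun=> erefl) (gf k) _.
apply: (word_iso_perp gP); apply: vP; first exact: (word_iso_involution fP).
exact: (word_iso_perp fP).
Qed.

Lemma word_iso_letter f g : word_iso P P' f g -> word_iso P' P g f ->
  exists h : S -> S', forall s, same_par (f [:: (s, true)]) [:: (h s, true)].
Proof.
move=> fP gP; suff /choice[h hP] : forall s, exists s',
  same_par (f [:: (s, true)]) [:: (s', true)] by exists h.
move=> s; apply: (vertex_likeP P_sym'); apply: (word_iso_vertex_like fP gP).
by apply: (vertex_like_letter P_sym P_ext) => //; exact: letter_involution.
Qed.

End Rigidity.

Lemma word_iso_adj (S S' : eqType) (P : S -> S -> Prop) (P' : S' -> S' -> Prop)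
    f g (h : S -> S') :
  (forall s t, P s t -> P t s) -> (forall s t, P' s t -> P' t s) ->
  (forall s, ~ P s s) -> injective h ->
  word_iso P P' f g ->
  (forall s, same_par (f [:: (s, true)]) [:: (h s, true)]) ->
  forall s t, P s t -> P' (h s) (h t).
Proof.
move=> P_sym P_sym' P_irr h_inj fP hP s t Pst.
have st : s <> t by move=> st; rewrite st in Pst; exact: P_irr Pst.
apply/(perp_letter P_sym'); first by move=> /h_inj.
by apply: perp_same_par (hP s) (hP t) _; apply: (word_iso_perp fP); apply/perp_letter.
Qed.

(** The image of a generator has the parities of a unique generator, which defines [h] and [k]. They
    are inverse to each other because letters with the same parities are equal. *)
Theorem word_iso_graph_iso (S S' : eqType) (P : S -> S -> Prop)
    (P' : S' -> S' -> Prop) f g :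
  (forall s t, P s t -> P t s) -> (forall s t, P' s t -> P' t s) ->
  (forall s, ~ P s s) -> (forall s, ~ P' s s) ->
  extension_property P -> extension_property P' ->
  word_iso P P' f g -> word_iso P' P g f ->
  exists (h : S -> S') (k : S' -> S), graph_iso P P' h k.
Proof.
move=> Ps Ps' Pi Pi' Pe Pe' fP gP.
have [h hP] := word_iso_letter Ps Ps' Pe fP gP.
have [k kP] := word_iso_letter Ps' Ps Pe' gP fP.
have hK : cancel h k.
  move=> s; apply: same_par_letter_inj; apply: same_par_trans (same_parS (kP _)) _.
  apply: same_par_trans (word_iso_same_par gP (same_parS (hP s))) _ => t.
  exact: par_eq (word_isoK fP _).
have kK : cancel k h.
  move=> s; apply: same_par_letter_inj; apply: same_par_trans (same_parS (hP _)) _.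
  apply: same_par_trans (word_iso_same_par fP (same_parS (kP s))) _ => t.
  exact: par_eq (word_isoK gP _).
exists h, k; split=> //.
  by apply: (word_iso_adj Ps Ps' Pi (can_inj hK) fP).
by apply: (word_iso_adj Ps' Ps Pi' (can_inj kK) gP).
Qed.

Lemma isomorphic_word_map (S S' : Type) (P : S -> S -> Prop)
    (P' : S' -> S' -> Prop) (M M' : structure Lstar) (ev : word S -> M)
    (ev' : word S' -> M') (F : M -> M') (f : word S -> word S') :
  presented P ev -> presented P' ev' ->
  (forall (R : symb Lstar) (t : (arity R).-tuple M),
      interp t -> interp (map_tuple F t)) ->
  (forall u, ev' (f u) = F (ev u)) ->
  (forall u v, racg_eq P' (f (u ++ v)) (f u ++ f v)) /\ racg_eq P' (f [::]) [::].
Proof.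
move=> pM pM' FI fE; split=> [u v|].
  have := FI (3, 0) [tuple ev u; ev v; ev (u ++ v)].
  rewrite (@interp_words _ P _ _ _ _ [:: u; v; u ++ v] pM)//.
  rewrite (@interp_words _ P' _ _ _ _ [:: f u; f v; f (u ++ v)] pM')//=.
    by move=> /(_ (word_eq_refl _ _)); exact: word_eq_sym.
  by rewrite !fE.
have := FI (1, 0) [tuple ev [::]].
rewrite (@interp_words _ P _ _ _ _ [:: [::]] pM)//.
rewrite (@interp_words _ P' _ _ _ _ [:: f [::]] pM')//=.
  by apply; exact: word_eq_refl.
by rewrite fE.
Qed.

Lemma isomorphic_graph_iso (S S' : eqType) (P : S -> S -> Prop)
    (P' : S' -> S' -> Prop) (M M' : structure Lstar) (ev : word S -> M)
    (ev' : word S' -> M') :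
  (forall s t, P s t -> P t s) -> (forall s t, P' s t -> P' t s) ->
  (forall s, ~ P s s) -> (forall s, ~ P' s s) ->
  extension_property P -> extension_property P' ->
  presented P ev -> presented P' ev' -> isomorphic M M' ->
  exists (h : S -> S') (k : S' -> S), graph_iso P P' h k.
Proof.
move=> Ps Ps' Pi Pi' Pe Pe' pM pM' [F [G FK GK] FI].
have [surj evP _] := pM; have [surj' evP' _] := pM'.
have [f fE] := choice (fun u => surj' (F (ev u))).
have [g gE] := choice (fun u => surj (G (ev' u))).
have GI (R : symb Lstar) (t : (arity R).-tuple M') :
    interp t -> interp (map_tuple G t).
  move=> tI; apply/FI; have -> // : map_tuple F (map_tuple G t) = t.
  by apply: val_inj; rewrite /= (mapK GK).
have FI' (R : symb Lstar) (t : (arity R).-tuple M) :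
    interp t -> interp (map_tuple F t) by move=> /FI.
have [fM f0] := isomorphic_word_map pM pM' FI' fE.
have [gM g0] := isomorphic_word_map pM' pM GI gE.
apply: (word_iso_graph_iso (f := f) (g := g)) => //; split=> //.
- by move=> u v /evP uv; apply/evP'; rewrite !fE uv.
- by move=> u; apply/evP; rewrite gE fE.
- by move=> u v /evP' uv; apply/evP; rewrite !gE uv.
- by move=> u; apply/evP'; rewrite fE gE.
Qed.

(** * Elementary equivalence *)

Section BackAndForth.
Variables (S S' : eqType) (P : S -> S -> Prop) (P' : S' -> S' -> Prop).

Definition partial_iso (D : seq (S * S')) :=
  forall p q, p \in D -> q \in D ->
    (p.1 = q.1 <-> p.2 = q.2) /\ (p.1 <> q.1 -> P p.1 q.1 <-> P' p.2 q.2).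

(** A word over pairs carries corresponding words on both sides. The finite map with graph [D] is
    undefined elsewhere, and [pmap_word] deletes the other letters, so a derivation that uses
    generators outside [D] still yields one on the other side. *)
Lemma partial_iso_eq D (u v : word (S * S')) : partial_iso D ->
  (forall p, p \in u -> p.1 \in D) -> (forall p, p \in v -> p.1 \in D) ->
  racg_eq P (map_word fst u) (map_word fst v) ->
  racg_eq P' (map_word snd u) (map_word snd v).
Proof.
move=> DP uD vD.
pose f s := omap snd (ohead [seq p <- D | p.1 == s]).
have fE s x : f s = Some x -> (s, x) \in D.
  rewrite /f; case E: [seq p <- D | p.1 == s] => [//|[y z] r] /= [<-].
  have: (y, z) \in [seq p <- D | p.1 == s] by rewrite E mem_head.
  by rewrite mem_filter => /andP[/eqP <-].
have fD p : p \in D -> f p.1 = Some p.2.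
  move=> pD; case fp: (f p.1) => [x|].
    by have [[/(_ erefl)/= <-]] := DP _ _ (fE _ _ fp) pD.
  move: fp; rewrite /f; have: p \in [seq q <- D | q.1 == p.1].
    by rewrite mem_filter eqxx.
  by case: [seq q <- D | q.1 == p.1].
have fu (w : word (S * S')) : (forall p, p \in w -> p.1 \in D) ->
    pmap_word f (map_word fst w) = map_word snd w.
  elim: w => //= -[p b] w IH wD /=.
  rewrite fD /= ?IH//; first by move=> q qw; apply: wD; rewrite inE qw orbT.
  exact: (wD (p, b) (mem_head _ _)).
move=> /(pmap_word_eq (f := f) (P' := P')); rewrite !fu//; apply.
  by move=> s t x /fE sD /fE tD; have [[_ /(_ erefl)]] := DP _ _ sD tD.
move=> s t x y st Pst /fE sD /fE tD.
by have [_ /(_ st)[/(_ Pst)]] := DP _ _ sD tD.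
Qed.

Hypothesis P_sym : forall s t, P s t -> P t s.
Hypothesis P_sym' : forall s t, P' s t -> P' t s.
Hypothesis P_ext' : extension_property P'.

Lemma partial_iso_extend D s : partial_iso D -> exists D', [/\ partial_iso D',
  {subset D <= D'} & exists x, (s, x) \in D'].
Proof.
move=> DP; case: (pselect (exists x, (s, x) \in D)) => [sD|sD].
  by exists D; split.
have neD p : p \in D -> s <> p.1.
  by move=> pD sp; apply: sD; exists p.2; rewrite sp -surjective_pairing.
(* The image of [s] has to be adjacent to [U] and to avoid [V]. *)
pose U := [seq p.2 | p <- D & `[< P s p.1 >]].
pose V := [seq p.2 | p <- D & ~~ `[< P s p.1 >]].
have [|z [zUV zU zV]] := P_ext' (U := U) (V := V).
  move=> x /mapP[p]; rewrite mem_filter => /andP[sp pD] ->.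
  apply/mapP => -[q]; rewrite mem_filter => /andP[sq qD] pq.
  by have [[_ /(_ pq) pq1] _] := DP _ _ pD qD; rewrite -pq1 sp in sq.
have zD p : p \in D -> z <> p.2 /\ (P s p.1 <-> P' z p.2).
  move=> pD; have UVp : (p.2 \in U) \/ (p.2 \in V).
    case sp: `[< P s p.1 >]; [left|right]; apply/mapP; exists p => //.
      by rewrite mem_filter sp.
    by rewrite mem_filter sp.
  split.
    move=> zp; move/negP: zUV; apply; rewrite mem_cat zp.
    by case: UVp => ->; rewrite ?orbT.
  split=> [sp|zp].
    apply: zU; apply/mapP; exists p => //; rewrite mem_filter pD andbT.
    exact/asboolP.
  apply: contrapT => sp; apply: zV zp; apply/mapP; exists p => //.
  by rewrite mem_filter pD andbT; apply/asboolPn.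
exists ((s, z) :: D); split; last by exists z; exact: mem_head.
  move=> p q; rewrite !inE => /orP[/eqP->|pD] /orP[/eqP->|qD] /=.
  - by split.
  - have [zq sq] := zD q qD; split; last by move=> _.
    by split=> // sq'; case: (neD q qD).
  - have [zp sp] := zD p pD; split.
      by split=> [/esym/(neD p pD)//|/esym/zp].
    move=> _; split=> [/P_sym/sp/P_sym'//|/P_sym'/sp/P_sym//].
  - exact: DP.
by move=> p pD; rewrite inE pD orbT.
Qed.

Lemma partial_iso_cover D (u : word S) : partial_iso D ->
  exists D', [/\ partial_iso D', {subset D <= D'} &
    exists2 w : word (S * S'), (forall p, p \in w -> p.1 \in D') & map_word fst w = u].
Proof.
elim: u D => [|[s b] u IH] D DP; first by exists D; split=> //; exists [::].
have [D1 [DP1 sD1 [x sx]]] := partial_iso_extend s DP.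
have [D2 [DP2 sD2 [w wD wu]]] := IH D1 DP1.
exists D2; split=> //; first by move=> p /sD1/sD2.
exists (((s, x), b) :: w); last by rewrite /= wu.
by move=> p; rewrite inE => /orP[/eqP->/=|/wD//]; exact: sD2.
Qed.

End BackAndForth.

Definition swap_word (S S' : Type) (w : word (S * S')) : word (S' * S) :=
  map_word (fun p => (p.2, p.1)) w.

Lemma partial_iso_swap (S S' : eqType) (P : S -> S -> Prop)
    (P' : S' -> S' -> Prop) (D : seq (S * S')) :
  partial_iso P P' D -> partial_iso P' P [seq (p.2, p.1) | p <- D].
Proof.
move=> DP _ _ /mapP[p pD ->] /mapP[q qD ->] /=.
have [E1 E2] := DP p q pD qD; split; first by rewrite E1.
by move=> pq; apply: iff_sym; apply: E2 => /E1.
Qed.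

Lemma partial_iso_cover' (S S' : eqType) (P : S -> S -> Prop)
    (P' : S' -> S' -> Prop) (D : seq (S * S')) (u : word S') :
  (forall s t, P s t -> P t s) -> (forall s t, P' s t -> P' t s) ->
  extension_property P -> partial_iso P P' D ->
  exists D', [/\ partial_iso P P' D', {subset D <= D'} &
    exists2 w : word (S * S'), (forall p, p \in w -> p.1 \in D') & map_word snd w = u].
Proof.
move=> Ps Ps' Pe /partial_iso_swap DP.
have [D' [DP' sD' [w wD wu]]] := partial_iso_cover Ps' Ps Pe u DP.
exists [seq (p.2, p.1) | p <- D']; split.
- exact: partial_iso_swap.
- move=> p pD; apply/mapP; exists (p.2, p.1); last by case: p {pD}.
  by apply: sD'; apply/mapP; exists p.
exists (swap_word w).
  by move=> _ /mapP[p pw ->] /=; apply/mapP; exists p.1 => //; exact: wD.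
by rewrite -wu /swap_word /map_word -map_comp; apply: eq_map => -[[]].
Qed.

Lemma partial_iso_eqE (S S' : eqType) (P : S -> S -> Prop)
    (P' : S' -> S' -> Prop) (D : seq (S * S')) (u v : word (S * S')) :
  partial_iso P P' D ->
  (forall p, p \in u -> p.1 \in D) -> (forall p, p \in v -> p.1 \in D) ->
  racg_eq P (map_word fst u) (map_word fst v) <->
  racg_eq P' (map_word snd u) (map_word snd v).
Proof.
move=> DP uD vD; split; first exact: (partial_iso_eq DP).
have E w : map_word snd w = map_word fst (swap_word w) :> word S'.
  by rewrite /swap_word /map_word -map_comp; apply: eq_map => -[[]].
have E' w : map_word fst w = map_word snd (swap_word w) :> word S.
  by rewrite /swap_word /map_word -map_comp; apply: eq_map => -[[]].
rewrite !E !E'; apply: (partial_iso_eq (partial_iso_swap DP)).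
  by move=> _ /mapP[p pw ->] /=; apply/mapP; exists p.1 => //; exact: uD.
by move=> _ /mapP[p pw ->] /=; apply/mapP; exists p.1 => //; exact: vD.
Qed.

Section ElementaryEquivalence.
Variables (S S' : eqType) (P : S -> S -> Prop) (P' : S' -> S' -> Prop).
Hypothesis P_sym : forall s t, P s t -> P t s.
Hypothesis P_sym' : forall s t, P' s t -> P' t s.
Hypothesis P_ext : extension_property P.
Hypothesis P_ext' : extension_property P'.
Variables (M M' : structure Lstar) (ev : word S -> M) (ev' : word S' -> M').
Hypothesis pM : presented P ev.
Hypothesis pM' : presented P' ev'.

Lemma partial_iso_atom D i (us : seq (word (S * S'))) : partial_iso P P' D ->
  (forall u, u \in us -> forall p, p \in u -> p.1 \in D) ->
  racg_atom P i (map (map_word fst) us) <-> racg_atom P' i (map (map_word snd) us).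
Proof.
move=> DP usD.
have catD (u v : word (S * S')) : u \in us -> v \in us ->
    forall p, p \in u ++ v -> p.1 \in D.
  by move=> uus vus p; rewrite mem_cat => /orP[]; apply: usD.
have nilD (p : S * S' * bool) : p \in [::] -> p.1 \in D by [].
case: i => //; case: us usD catD => [|u [|v [|w [|? ?]]]] //= usD catD.
- apply: (partial_iso_eqE (v := [::]) DP) => //.
  by apply: usD; rewrite inE.
- rewrite -!map_word_cat; apply: (partial_iso_eqE (v := [::]) DP) => //.
  by apply: catD; rewrite !inE eqxx ?orbT.
- rewrite -!map_word_cat; apply: (partial_iso_eqE DP).
    by apply: catD; rewrite !inE eqxx ?orbT.
  by apply: usD; rewrite !inE eqxx ?orbT.
Qed.

(** Variables are valued in words over pairs, read on either side. At a quantifier the new element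
    is written as a word, and [D] is extended to cover its finitely many letters. *)
Lemma partial_iso_sat n (phi : formula Lstar n) D (v : 'I_n -> word (S * S')) :
  partial_iso P P' D -> (forall i p, p \in v i -> p.1 \in D) ->
  sat phi (fun i => ev (map_word fst (v i))) <->
  sat phi (fun i => ev' (map_word snd (v i))).
Proof.
have [surj evP _] := pM; have [surj' evP' _] := pM'.
elim: phi D v => {n} [n|n i j|n R t|n p IHp q IHq|n p IHp] D v DP vD.
- by [].
- by rewrite /= evP evP'; exact: (partial_iso_eqE DP (vD i) (vD j)).
- rewrite [sat _ _]/= (interp_words (us := map (map_word fst) (map v t)) pM); last first.
    by rewrite /= -!map_comp.
  rewrite [X in _ <-> X]/=.
  rewrite (interp_words (us := map (map_word snd) (map v t)) pM'); last first.
    by rewrite /= -!map_comp.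
  by apply: (partial_iso_atom _ DP) => _ /mapP[i _ ->]; exact: vD.
- by rewrite /= (IHp D v)// (IHq D v).
have consE (T : Type) (h : word (S * S') -> T) w :
    env_cons (h w) (fun i => h (v i)) = fun i => h (env_cons w v i).
  by apply/funext => i; rewrite /env_cons; case: unlift.
have consD D' w : {subset D <= D'} -> (forall p, p \in w -> p.1 \in D') ->
    forall i p, p \in env_cons w v i -> p.1 \in D'.
  move=> sD wD i r; rewrite /env_cons; case: unlift => [j|]; last exact: wD.
  by move=> /vD/sD.
rewrite /=; split=> sp a.
  have [u <-] := surj' a.
  have [D' [DP' sD' [w wD <-]]] := partial_iso_cover' u P_sym P_sym' P_ext DP.
  rewrite (consE _ (fun w => ev' (map_word snd w))).
  apply/(IHp D') => //; first exact: consD.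
  by rewrite -(consE _ (fun w => ev (map_word fst w))); exact: sp.
have [u <-] := surj a.
have [D' [DP' sD' [w wD <-]]] := partial_iso_cover P_sym P_sym' P_ext' u DP.
rewrite (consE _ (fun w => ev (map_word fst w))).
apply/(IHp D') => //; first exact: consD.
by rewrite -(consE _ (fun w => ev' (map_word snd w))); exact: sp.
Qed.

Theorem presented_theory : theory_of M = theory_of M'.
Proof.
have H phi : holds M phi <-> holds M' phi.
  have := @partial_iso_sat 0 phi [::] (@empty_env _).
  rewrite (_ : (fun i => ev _) = @empty_env M); last by apply/funext => -[].
  rewrite (_ : (fun i => ev' _) = @empty_env M'); last by apply/funext => -[].
  by apply=> // -[].
by apply/seteqP; split=> phi /H.
Qed.

End ElementaryEquivalence.

(** * The theory of the random graph *)

Fixpoint close_all (L : language) n : formula L n -> sentence L :=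
  match n with
  | 0 => id
  | m.+1 => fun phi => close_all (fAll phi)
  end.

Lemma holds_close_all (L : language) (M : structure L) n (phi : formula L n) :
  holds M (close_all phi) <-> forall v : 'I_n -> M, sat phi v.
Proof.
elim: n phi => [|n IH] phi /=.
  rewrite /holds; split=> // phiP v.
  by rewrite (_ : v = @empty_env M)//; apply/funext => -[].
rewrite IH; split=> phiP v => [|a]; last exact: phiP.
have := phiP (fun i => v (lift ord0 i)) (v ord0); congr sat.
by apply/funext => i; rewrite /env_cons; case: unliftP => [j|] ->.
Qed.

Definition fAnd (L : language) n (p q : formula L n) : formula L n :=
  fNot (fImp p (fNot q)).

Lemma sat_fAnd (L : language) (M : structure L) n (p q : formula L n)
    (v : 'I_n -> M) : sat (fAnd p q) v <-> sat p v /\ sat q v.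
Proof.
split=> /= [pq|[pv qv]]; last by apply.
by split; apply: contrapT => h; apply: pq.
Qed.

Definition fBigAnd (L : language) n (I : finType) (F : I -> formula L n) :=
  foldr (fun i p => fAnd (F i) p) (fNot (fFalse L n)) (enum I).

Lemma sat_fBigAnd (L : language) (M : structure L) n (I : finType)
    (F : I -> formula L n) (v : 'I_n -> M) :
  sat (fBigAnd F) v <-> forall i, sat (F i) v.
Proof.
rewrite /fBigAnd; transitivity (forall i, i \in enum I -> sat (F i) v); last first.
  by split=> FP i; [apply: FP; rewrite mem_enum|move=> _; exact: FP].
elim: (enum I) => [|i s IH]; first by split=> [_ i|_ []].
rewrite sat_fAnd IH; split=> [[iP sP] j|sP].
  by rewrite inE => /orP[/eqP->|/sP].
by split=> [|j js]; apply: sP; rewrite inE ?eqxx// js orbT.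
Qed.

Definition fEx (L : language) n (p : formula L n.+1) : formula L n :=
  fNot (fAll (fNot p)).

Lemma sat_fEx (L : language) (M : structure L) n (p : formula L n.+1)
    (v : 'I_n -> M) : sat (fEx p) v <-> exists a, sat p (env_cons a v).
Proof.
split=> /= [pP|[a ap] pP]; last exact: pP ap.
by apply: contrapT => np; apply: pP => a ap; apply: np; exists a.
Qed.

Definition fEdge n (i j : 'I_n) : formula Lgraph n :=
  @fRel Lgraph n tt [tuple i; j].

Definition fIf (L : language) n (b : bool) (p : formula L n) : formula L n :=
  if b then p else fNot (fFalse L n).

Lemma sat_fIf (L : language) (M : structure L) n b (p : formula L n)
    (v : 'I_n -> M) : sat (fIf b p) v <-> (b -> sat p v).
Proof. by case: b; [split=> // h; exact: h|split=> // _ []]. Qed.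

(* [c i] tells whether the i-th vertex is to be joined to the new vertex. *)
Definition ext_formula n (c : 'I_n -> bool) : formula Lgraph n :=
  fImp
    (fBigAnd (fun i => fBigAnd (fun j =>
      fIf (c i && ~~ c j) (fNot (fEq Lgraph i j)))))
    (fEx (fBigAnd (fun i => fAnd (fNot (fEq Lgraph ord0 (lift ord0 i)))
      (if c i then fEdge ord0 (lift ord0 i)
       else fNot (fEdge ord0 (lift ord0 i)))))).

Lemma sat_ext_formula (V : Type) (E : V -> V -> Prop) n (c : 'I_n -> bool)
    (v : 'I_n -> V) :
  sat (M := graph_structure E) (ext_formula c) v <->
  ((forall i j, c i -> ~~ c j -> v i <> v j) ->
   exists z, forall i, z <> v i /\ if c i then E z (v i) else ~ E z (v i)).
Proof.
have env0 (a : V) : env_cons a v ord0 = a by rewrite /env_cons unlift_none.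
have envS (a : V) i : env_cons a v (lift ord0 i) = v i by rewrite /env_cons liftK.
rewrite [X in X <-> _]/=; split=> + cP.
  case/(_ _)/(sat_fEx (M := graph_structure E)).
    apply/sat_fBigAnd => i; apply/sat_fBigAnd => j; apply/sat_fIf.
    by move=> /andP[ci cj]; exact: cP.
  move=> z /sat_fBigAnd zP; exists z => i.
  have /sat_fAnd := zP i; rewrite /= env0 envS => -[zi Ei]; split=> //.
  by case: (c i) Ei; rewrite /= env0 envS.
case=> [i j ci cj|z zP].
  move/sat_fBigAnd/(_ i)/sat_fBigAnd/(_ j)/sat_fIf: cP; apply.
  by rewrite ci.
apply/(sat_fEx (M := graph_structure E)); exists z; apply/sat_fBigAnd => i.
have [zi Ei] := zP i; apply/sat_fAnd; rewrite /= env0 envS; split=> //.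
by case: (c i) Ei; rewrite /= env0 envS.
Qed.

Lemma T_rg_ext n (c : 'I_n -> bool) : T_rg (close_all (ext_formula c)).
Proof.
rewrite /T_rg /theory_of /=; apply/holds_close_all => v; apply/sat_ext_formula.
move=> cP; pose U := [seq v i | i <- enum 'I_n & c i].
pose V := [seq v i | i <- enum 'I_n & ~~ c i].
have [|z [zUV zU zV]] := @rado_extension U V.
  apply/hasP => -[x /mapP[i]]; rewrite mem_filter => /andP[ci _] ->.
  move=> /mapP[j]; rewrite mem_filter => /andP[cj _] ij.
  by apply: (cP j i cj ci).
exists z => i; case ci: (c i).
  have iU : v i \in U by apply/mapP; exists i => //; rewrite mem_filter ci mem_enum.
  split; last exact: (allP zU).
  by move=> zi; move/negP: zUV; apply; rewrite mem_cat zi iU.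
have iV : v i \in V by apply/mapP; exists i => //; rewrite mem_filter ci mem_enum.
split; first by move=> zi; move/negP: zUV; apply; rewrite mem_cat zi iV orbT.
by move=> zi; move/hasPn/(_ _ iV)/negP: zV.
Qed.

Lemma T_rg_extension_property (V : eqType) (E : V -> V -> Prop) :
  models (graph_structure E) T_rg -> extension_property E.
Proof.
move=> EP U W UW; pose s := U ++ W.
(* The vertices of [U] are the first ones in the list. Repetitions are harmless, as [ext_formula]
   separates only vertices with different marks. *)
pose c (i : 'I_(size s)) := i < size U.
pose v (i : 'I_(size s)) := tnth (in_tuple s) i.
have /holds_close_all/(_ v)/sat_ext_formula := EP _ (T_rg_ext c).
have vE (i : 'I_(size s)) x0 : v i = nth x0 s i by rewrite /v (tnth_nth x0).
have vU i : c i -> v i \in U.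
  by rewrite /c => ci; rewrite (vE i (v i)) nth_cat ci mem_nth.
have vW i : ~~ c i -> v i \in W.
  rewrite /c => ci; rewrite (vE i (v i)) nth_cat (negbTE ci) mem_nth//.
  by rewrite ltn_subLR -?size_cat// leqNgt.
case=> [i j /vU iU /vW jW ij|z zP].
  by have := UW _ iU; rewrite ij jW.
have idx x : x \in s -> exists2 i : 'I_(size s), (i : nat) = index x s & v i = x.
  move=> xs; have lt_is : index x s < size s by rewrite index_mem.
  by exists (Ordinal lt_is) => //; rewrite (vE _ x) nth_index.
exists z; split.
- by apply/negP => /idx[i _ vi]; have [] := zP i; rewrite vi.
- move=> x xU; have [|i iE vi] := idx x; first by rewrite mem_cat xU.
  have [_] := zP i; rewrite vi ifT// /c iE index_cat xU index_mem//.
- move=> x xW; have [|i iE vi] := idx x; first by rewrite mem_cat xW orbT.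
  have [_] := zP i; rewrite vi ifF// /c iE index_cat ifF ?ltnNge ?leq_addr//.
  by apply/negbTE/negP => /UW; rewrite xW.
Qed.

(** * Right-angled Coxeter groups presented by their commutation relation *)

Lemma word_eval_cat (W : groupType) (S : Type) (gen : S -> W) u v :
  word_eval gen (u ++ v) = (word_eval gen u * word_eval gen v)%g.
Proof. exact: big_cat. Qed.

Definition commuting (W : groupType) (S : Type) (gen : S -> W) (s s' : S) :=
  s <> s' /\ (gen s * gen s' = gen s' * gen s)%g.

(** The relation [P] of the presentation may be smaller than commutation and need not be symmetric.
    Replacing it by [commuting gen] changes nothing, since the additional relators already hold in
    [W]. *)
Lemma racg_presented (W : groupType) (S : Type) (gen : S -> W) :
  is_racg gen ->
  presented (M := group_structure W) (commuting gen) (word_eval gen).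
Proof.
move=> [P [surj evP]]; have sq s : (gen s * gen s = 1)%g.
  have /evP : racg_eq P [:: (s, true); (s, true)] [::].
    by apply: (@word_eq_rel _ _ [::] [:: _; _] [::]); left; exists s.
  by rewrite /word_eval big_nil !big_cons big_nil mulg1.
have evC u v : word_eval gen u = word_eval gen v <-> racg_eq (commuting gen) u v.
  rewrite evP; split; apply: word_eq_sub => r.
    move=> [[s ->]|[s [t [st Pst ->]]]].
      by apply: (@word_eq_rel _ _ [::] [:: _; _] [::]); left; exists s.
    apply: (@word_eq_rel _ _ [::] [:: _; _; _; _] [::]); right; exists s, t.
    split=> //; split=> //.
    have /evP : racg_eq P [:: (s, true); (t, true); (s, true); (t, true)] [::].
      by apply: (@word_eq_rel _ _ [::] [:: _; _; _; _] [::]); right; exists s, t.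
    rewrite /word_eval big_nil !big_cons big_nil mulg1 /= => E.
    (* Multiplying by [t s] on the right turns the relator into commutation; the left factor
       [t s s t] is trivial. *)
    have := congr1 (fun x => gen t * (gen s * (gen s * (gen t * x))))%g
      (congr1 (fun x => x * gen t * gen s)%g E).
    have K x (y : W) : (gen x * (gen x * y) = y)%g by rewrite mulgA sq mul1g.
    by rewrite mul1g -!mulgA !K sq mulg1.
  move=> rP; apply/evP; rewrite /word_eval big_nil.
  case: rP => [[s ->]|[s [t [st [_ C] ->]]]]; rewrite !big_cons big_nil mulg1 /=.
    exact: sq.
  by rewrite [X in (_ * X)%g]mulgA -C -mulgA sq mulg1.
split=> // R t; split.
  rewrite /=; case: R t => n [|i] [[|x [|y [|z [|? ?]]]] /= tP] //.
  - move=> ->; exists [:: [::]]; split; last exact: word_eq_refl.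
    by rewrite /= /word_eval big_nil.
  - have [u uE] := surj x; have [v vE] := surj y.
    move=> xy; exists [:: u; v]; rewrite /= uE vE; split=> //; apply/evC.
    by rewrite word_eval_cat uE vE -xy mulgV /word_eval big_nil.
  - have [u uE] := surj x; have [v vE] := surj y; have [w wE] := surj z.
    move=> xyz; exists [:: u; v; w]; rewrite /= uE vE wE; split=> //; apply/evC.
    by rewrite word_eval_cat uE vE wE.
move=> [us []]; rewrite /=; case: R t => n [|i] t //=.
case: us => [|u [|v [|w [|? ?]]]] //= <- /evC; rewrite ?word_eval_cat.
- by rewrite [X in _ = X -> _]/word_eval big_nil.
- by rewrite [X in _ = X -> _]/word_eval big_nil => /mulg1_eq.
- by [].
Qed.

(** * Coding structures into graphs *)

(* The vertices are the elements of the structure and, for every potential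
   atom (i, s) (the i-th relation symbol of arity [size s] applied to s) and
   every j, a vertex ((i, s), j): the hub of the atom for j = 0, the mark of its
   truth for j = 1, the link to its k-th argument for j = k + 2. *)
Definition incidence_vertex (K : Type) : Type := K + (nat * seq K) * nat.

(* v is labelled by the number of its pendant vertices (v, i), i < label v; the
   remaining vertices (v, i) are isolated in the labelled graph. *)
Definition labelled_vertex (K : Type) : Type :=
  incidence_vertex K + incidence_vertex K * nat.

Definition core_vertex (K : Type) : Type := K + labelled_vertex K.

(* [Node n U] is the n-th vertex added in order to be adjacent to U only. *)
Definition code_vertex (K : Type) : Type := GenTree.tree (core_vertex K).

HB.instance Definition _ (K : choiceType) :=
  Choice.copy (incidence_vertex K) (K + (nat * seq K) * nat)%type.
HB.instance Definition _ (K : choiceType) :=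
  Choice.copy (labelled_vertex K) (incidence_vertex K + incidence_vertex K * nat)%type.
HB.instance Definition _ (K : choiceType) :=
  Choice.copy (core_vertex K) (K + labelled_vertex K)%type.
HB.instance Definition _ (K : choiceType) :=
  Choice.copy (code_vertex K) (GenTree.tree (core_vertex K)).

Section CodeGraph.
Variables (K : choiceType) (A : interpretation Lstar K).

(** The arity is read off from [size s], so that atoms are indexed by plain pairs. *)
Definition atom_true (i : nat) (s : seq K) : Prop := @A (size s, i) (in_tuple s).

Definition incident (v w : incidence_vertex K) : Prop :=
  match v, w with
  | inl x, inr (_, s, j.+2) => onth s j = Some x
  | inr (a, 0), inr (b, 1) => a = b /\ atom_true a.1 a.2
  | inr (a, 0), inr (b, _.+2) => a = b
  | _, _ => False
  end.

Definition incidence_adj v w := incident v w \/ incident w v.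

(** Elements get 2; the other vertices get at least 3, injectively in the symbol, the arity and the
    role [j]. Labels are at least 2 so that no incidence vertex is itself pendant. *)
Definition label (v : incidence_vertex K) : nat :=
  match v with
  | inl _ => 2
  | inr (i, s, j) => (choice.pickle (i, size s, j)).+3
  end.

Definition labelled_adj (x y : labelled_vertex K) : Prop :=
  match x, y with
  | inl v, inl w => incidence_adj v w
  | inl v, inr (w, i) | inr (w, i), inl v => v = w /\ i < label v
  | inr _, inr _ => False
  end.

Definition core_adj (x y : core_vertex K) : Prop :=
  match x, y with
  | inl _, inl _ => False
  | inr a, inr b => labelled_adj a b
  | _, _ => True
  end.

Definition children (t : code_vertex K) : seq (code_vertex K) :=
  if t is GenTree.Node _ ts then ts else [::].

Definition code_adj (t u : code_vertex K) : Prop :=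
  match t, u with
  | GenTree.Leaf x, GenTree.Leaf y => core_adj x y
  | _, _ => t \in children u \/ u \in children t
  end.

Lemma incidence_adj_irr v : ~ incidence_adj v v.
Proof. by rewrite /incidence_adj /incident; case: v => [x|[[i s] [|[|j]]]] []. Qed.

Lemma core_adj_sym x y : core_adj x y -> core_adj y x.
Proof. by case: x y => [?|[?|[? ?]]] [?|[?|[? ?]]] //= []; [right|left]. Qed.

Lemma code_adj_sym t u : code_adj t u -> code_adj u t.
Proof.
case: t u => [x|n ts] [y|m us]; first exact: core_adj_sym.
all: by move=> []; [right|left].
Qed.

(** The size of the encoding decreases along [children]; hence no tree is its own child and the
    graph has no loops. *)
Lemma children_size t u :
  t \in children u -> size (GenTree.encode t) < size (GenTree.encode u).
Proof.
case: u => [//|n us] /= tu; rewrite size_rcons size_flatten /shape -map_comp.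
apply: (@leq_trans (sumn [seq (size \o @GenTree.encode _) i | i <- us]).+1); last by [].
rewrite ltnS; elim: us tu => //= u us IH; rewrite inE => /orP[/eqP->|/IH le].
  exact: leq_addr.
exact: leq_trans le (leq_addl _ _).
Qed.

Lemma code_adj_irr t : ~ code_adj t t.
Proof.
have irr u : u \notin children u by apply/negP => /children_size; rewrite ltnn.
case: t => [[x|[v|[v i]]]|n ts] //=; first exact: incidence_adj_irr.
by have /negP := irr (GenTree.Node n ts); rewrite /= => ? [].
Qed.

(** The witness is [Node n U] with [n] above all tags in [U], in [V] and among the children of [V]:
    it is new, its children are exactly [U], and it is a child of no vertex of [V]. *)
Lemma code_extension : extension_property code_adj.
Proof.
move=> U V UV; pose L := U ++ V ++ flatten (map children V).
pose tag (t : code_vertex K) := if t is GenTree.Node n _ then n else 0.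
pose n := (\max_(t <- L) tag t).+1.
have zL : GenTree.Node n U \notin L.
  apply/negP => zL; have := @leq_bigmax_seq _ L predT tag _ zL isT.
  by rewrite /= ltnn.
exists (GenTree.Node n U); split.
- by apply: contra zL => zUV; rewrite /L catA mem_cat zUV.
- by move=> x xU; case: x xU => *; right.
move=> x xV xz.
have [xz'|xU] : (GenTree.Node n U : code_vertex K) \in children x \/ x \in U.
- by case: x xV xz.
- move/negP: zL; apply; rewrite /L !mem_cat; apply/orP; right; apply/orP; right.
  by apply/flattenP; exists (children x) => //; apply/mapP; exists x.
- by have := UV _ xU; rewrite xV.
Qed.

End CodeGraph.

(** * Functoriality of the coding *)

Section MapCode.
Variables (K K' : choiceType).

Definition incidence_map (f : K -> K') (v : incidence_vertex K) :
    incidence_vertex K' :=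
  match v with inl x => inl (f x) | inr (i, s, j) => inr (i, map f s, j) end.

Definition labelled_map f (x : labelled_vertex K) : labelled_vertex K' :=
  match x with
  | inl v => inl (incidence_map f v)
  | inr (v, i) => inr (incidence_map f v, i)
  end.

Definition core_map f (x : core_vertex K) : core_vertex K' :=
  match x with inl x => inl (f x) | inr x => inr (labelled_map f x) end.

Fixpoint tree_map (T T' : Type) (f : T -> T') (t : GenTree.tree T) :
    GenTree.tree T' :=
  match t with
  | GenTree.Leaf x => GenTree.Leaf (f x)
  | GenTree.Node n ts => GenTree.Node n (map (tree_map f) ts)
  end.

Variables (A : interpretation Lstar K) (B : interpretation Lstar K') (f : K -> K').
Hypothesis fAB : forall i s, atom_true A i s -> atom_true B i (map f s).

Lemma incident_map v w :
  incident A v w -> incident B (incidence_map f v) (incidence_map f w).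
Proof.
case: v w => [x|[[i s] [|[|j]]]] [y|[[i' s'] [|[|j']]]] //=.
- by rewrite onth_map => ->.
- by move=> [[<- <-] /fAB].
- by move=> [<- <-].
Qed.

Lemma label_map v : label (incidence_map f v) = label v.
Proof. by case: v => [//|[[i s] j]] /=; rewrite size_map. Qed.

Lemma core_adj_map x y : core_adj A x y -> core_adj B (core_map f x) (core_map f y).
Proof.
case: x y => [?|[v|[v i]]] [?|[w|[w j]]] //=.
- by move=> [] /incident_map; [left|right].
- by move=> [-> ?]; rewrite label_map.
- by move=> [-> ?]; rewrite label_map.
Qed.

Lemma code_adj_map t u : code_adj A t u ->
  code_adj B (tree_map (core_map f) t) (tree_map (core_map f) u).
Proof.
have childP v w : v \in children w ->
    tree_map (core_map f) v \in children (tree_map (core_map f) w : code_vertex K').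
  by case: w => //= n ws; exact: map_f.
case: t u => [x|n ts] [y|m us]; first exact: core_adj_map.
all: by move=> [] /childP; [left|right].
Qed.

End MapCode.

Lemma core_mapK (K K' : choiceType) (f : K -> K') (g : K' -> K) :
  cancel f g -> cancel (core_map f) (core_map g).
Proof.
move=> fK; have vK : cancel (incidence_map f) (incidence_map g).
  by case=> [x|[[i s] j]] /=; rewrite ?fK// (mapK fK).
by case=> [x|[v|[v i]]] /=; rewrite ?fK ?vK.
Qed.

Lemma tree_mapK (T T' : Type) (f : T -> T') (g : T' -> T) :
  cancel f g -> cancel (tree_map f) (tree_map g).
Proof.
move=> fK; elim=> [x|n ts IH] /=; first by rewrite fK.
by congr GenTree.Node; elim: ts IH => //= t ts IHts [-> /IHts ->].
Qed.

Lemma atom_trueP (K : choiceType) (A : interpretation Lstar K) n i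
    (t : n.-tuple K) : A (n, i) t <-> atom_true A i t.
Proof.
case: t => s sn; have E := eqP sn; move: sn; rewrite -{n}E => sn.
by rewrite /atom_true (_ : Tuple sn = in_tuple s)//; exact: val_inj.
Qed.

Lemma isomorphic_code (K : choiceType) (A B : interpretation Lstar K) :
  isomorphic (Structure A) (Structure B) ->
  exists f g, graph_iso (code_adj A) (code_adj B) f g.
Proof.
move=> [f [g fK gK] fAB].
have fI i s : atom_true A i s -> atom_true B i (map f s).
  by move=> /fAB /atom_trueP.
have gI i s : atom_true B i s -> atom_true A i (map g s).
  move=> sB; apply/(@atom_trueP _ A _ i (map_tuple g (in_tuple s)))/fAB.
  by apply/atom_trueP; rewrite /= (mapK gK).
exists (tree_map (core_map f)), (tree_map (core_map g)); split.
- exact/tree_mapK/core_mapK.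
- exact/tree_mapK/core_mapK.
- exact: code_adj_map.
- exact: code_adj_map.
Qed.

(** * Recovering the structure from its graph *)

(** An isomorphism that preserves an induced subgraph in both directions restricts to it; the layers
    of the coding are peeled off in this way. *)
Lemma graph_iso_restrict (X X0 : Type) (i : X0 -> X) (E E' : X -> X -> Prop) f g :
  injective i -> graph_iso E E' f g ->
  (forall x, exists y, f (i x) = i y) -> (forall x, exists y, g (i x) = i y) ->
  exists f0 g0,
    [/\ graph_iso (fun x y => E (i x) (i y)) (fun x y => E' (i x) (i y)) f0 g0,
        forall x, f (i x) = i (f0 x) & forall x, g (i x) = i (g0 x)].
Proof.
move=> i_inj [fK gK fP gP] /choice[f0 f0P] /choice[g0 g0P].
exists f0, g0; split=> //; split=> [x|x|x y|x y].
- by apply: i_inj; rewrite -g0P -f0P.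
- by apply: i_inj; rewrite -f0P -g0P.
- by rewrite -!f0P; exact: fP.
- by rewrite -!g0P; exact: gP.
Qed.

Section Invariants.
Variables (X : Type) (E : X -> X -> Prop).

(** The invariants of this section recognize in turn the leaves among all vertices, the independent
    set within the core, and the incidence vertices among the labelled ones. *)
Definition in_large_biclique x := exists S S' : set X,
  [/\ S x, ~ countable S, ~ countable S' & forall s s', S s -> S' s' -> E s s'].

Definition independent_nonneighbours x := forall y z, ~ E x y -> ~ E x z -> ~ E y z.

Definition pendant x := exists2 y, E x y & forall z, E x z -> z = y.

Definition has_pendant x := exists2 y, pendant y & E x y.

End Invariants.

Section InvariantsIso.
Variables (X : Type) (E E' : X -> X -> Prop) (f g : X -> X).
Hypothesis fP : graph_iso E E' f g.

Lemma in_large_biclique_iso x : in_large_biclique E x -> in_large_biclique E' (f x).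
Proof.
have [fK gK fE gE] := fP; move=> [S [S' [Sx nS nS' SS']]].
have cf (C : set X) : countable (f @` C) -> countable C.
  move=> fC; have -> : C = g @` (f @` C).
    by rewrite image_comp (_ : g \o f = id) ?image_id//; apply/funext.
  by apply: sub_countable fC; exact: card_image_le.
exists (f @` S), (f @` S'); split=> [|/cf|/cf|] //.
by move=> _ _ [s Ss <-] [s' Ss' <-]; exact/fE/SS'.
Qed.

Lemma independent_nonneighbours_iso x :
  independent_nonneighbours E x -> independent_nonneighbours E' (f x).
Proof.
have [fK gK fE gE] := fP; move=> xP y z xy xz yz.
apply: (xP (g y) (g z)) (gE _ _ yz).
  by move=> /fE; rewrite gK.
by move=> /fE; rewrite gK.
Qed.

Lemma pendant_iso x : pendant E x -> pendant E' (f x).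
Proof.
have [fK gK fE gE] := fP; move=> [y xy yP]; exists (f y); first exact: fE.
by move=> z /gE; rewrite fK => /yP <-; rewrite gK.
Qed.

Lemma has_pendant_iso x : has_pendant E x -> has_pendant E' (f x).
Proof.
have [_ _ fE _] := fP.
by move=> [y /pendant_iso py /fE xy]; exists (f y).
Qed.

End InvariantsIso.

Lemma card_le_inj (T U : Type) (B : set U) : [set: T] #<= B ->
  exists2 f : T -> U, injective f & forall x, B (f x).
Proof.
move=> /card_leP[h]; exists (fun x => set_val (h (to_setT x))).
  move=> x y /val_inj hxy; apply: (congr1 set_val (_ : to_setT x = to_setT y)).
  by apply: ('inj_h _ _ hxy); rewrite in_setT.
by move=> x; exact: set_valP.
Qed.

Section Recover.
Variables (K : choiceType).
Hypothesis K_uncountable : ~ countable [set: K].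
Implicit Types A B : interpretation Lstar K.

Lemma uncountable_range (T : Type) (h : K -> T) : injective h -> ~ countable (range h).
Proof.
move=> h_inj /countable_injP[e e_inj]; apply: K_uncountable.
apply/countable_injP; exists (e \o h) => x y _ _ /= exy; apply: h_inj.
by apply: e_inj exy; rewrite inE; [exists x|exists y].
Qed.

Lemma leaf_in_large_biclique A x : in_large_biclique (code_adj A) (GenTree.Leaf x).
Proof.
pose S1 := [set t : code_vertex K | if t is GenTree.Leaf (inl _) then True else False].
pose S2 := [set t : code_vertex K | if t is GenTree.Leaf (inr _) then True else False].
have nS1 : ~ countable S1.
  move=> cS; apply: (@uncountable_range _ (fun x =>
    GenTree.Leaf (inl x) : code_vertex K)); first by move=> ? ? [].
  by apply: sub_countable cS; apply: subset_card_le => _ [y _ <-].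
have nS2 : ~ countable S2.
  move=> cS; apply: (@uncountable_range _ (fun x =>
    GenTree.Leaf (inr (inl (inl x))) : code_vertex K)); first by move=> ? ? [].
  by apply: sub_countable cS; apply: subset_card_le => _ [y _ <-].
by case: x => x; [exists S1, S2|exists S2, S1]; split=> // -[[?|?]|? ?] [[?|?]|? ?].
Qed.

(** Apart from the finite set [U], the neighbours of [Node n U] are nodes having it as a child, so
    the side opposite to it contains infinitely many nodes [e i]. *)
Lemma node_not_in_large_biclique A n U :
  ~ in_large_biclique (code_adj A) (GenTree.Node n U).
Proof.
move=> [S [S' [Su nS nS' SS']]].
have [e e_inj eS'] : exists2 e : nat -> code_vertex K, injective e &
    forall i, S' (e i) /\ e i \notin U.
  have : ~ finite_set (S' `\` [set` U]).
    move=> fS; apply: nS'; apply: finite_set_countable.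
    by apply: (@sub_finite_set _ _ ((S' `\` [set` U]) `|` [set` U]));
      [move=> x Sx; case: (pselect ([set` U] x)) => ?; [right|left]
      |rewrite finite_setU; split=> //; exact: finite_seq].
  move=> /infiniteP/card_le_inj[e e_inj eS']; exists e => // i.
  by have [Se Ue] := eS' i; split=> //; apply/negP.
have eN i : exists m ts, e i = GenTree.Node m ts.
  have [Se Ue] := eS' i; have := SS' _ _ Su Se; case: (e i) Ue => [x|m ts] Ue /=.
    by case=> // xU; rewrite xU in Ue.
  by exists m, ts.
(* The [e i] have only countably many children altogether, so some [s] in the uncountable side is
   none of these. Every [e i] is then one of the finitely many children of [s]. *)
have [s [Ss se]] : exists s, S s /\ forall i, s \notin children (e i).
  apply: contrapT => nse; apply: nS.
  apply: (@sub_countable _ _ _ (\bigcup_i [set` children (e i)])).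
    apply: subset_card_le => s Ss; apply: contrapT => si; apply: nse.
    by exists s; split=> // i; apply/negP => sei; apply: si; exists i.
  apply: bigcup_countable => // i _; apply: finite_set_countable.
  exact: finite_seq.
have se' i : e i \in children s.
  have := SS' _ _ Ss (eS' i).1; have := se i; have [m [ts ->]] := eN i.
  by case: s {Ss se} => [x|k us] /negP sts [].
have := @uniq_leq_size _ (map e (iota 0 (size (children s)).+1)) (children s).
rewrite (map_inj_uniq e_inj) iota_uniq size_map size_iota ltnn => /(_ isT) H.
by suff : false by []; apply: H => _ /mapP[i _ ->].
Qed.

Lemma code_iso_leaf A B f g : graph_iso (code_adj A) (code_adj B) f g ->
  forall x, exists y, f (GenTree.Leaf x) = GenTree.Leaf y.
Proof.
move=> fP x; have := in_large_biclique_iso fP (leaf_in_large_biclique A x).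
case: (f _) => [y _|n U /node_not_in_large_biclique//]; by exists y.
Qed.

Lemma omega_independent A x : independent_nonneighbours (core_adj A) (inl x).
Proof. by move=> [y|y] [z|z] //= _ []. Qed.

Lemma label_gt1 (v : incidence_vertex K) : 1 < label v.
Proof. by case: v => [|[[? ?] ?]]. Qed.

(** Some incidence vertex [v] is different from [v0] and not adjacent to it; the edge from [v] to a
    pendant of [v] then joins two non-neighbours of [x]. *)
Lemma labelled_not_independent A x : ~ independent_nonneighbours (core_adj A) (inr x).
Proof.
have ex v0 : exists2 v, v0 <> v & ~ incidence_adj A v0 v.
  case: v0 => [k|[[i s] j]].
    by exists (inr (0, [::], 0)) => // -[].
  exists (inr (i.+1, s, j)); first by move=> [/n_Sn].
  by rewrite /incidence_adj /=; case: j => [|[|j]] [].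
case: x => [v0|[v0 i]] xP; have [v vv0 v0v] := ex v0;
  apply: (xP (inr (inl v)) (inr (inr (v, 0)))) => //=.
- by case.
- by split=> //; exact: ltnW (label_gt1 v).
- by move=> [/esym].
- by split=> //; exact: ltnW (label_gt1 v).
Qed.

Lemma core_iso_labelled A B f g : graph_iso (core_adj A) (core_adj B) f g ->
  forall x, exists y, f (inr x) = inr y.
Proof.
move=> fP x; case fx: (f (inr x)) => [k|y]; last by exists y.
have [fK _ _ _] := fP; have := @omega_independent B k; rewrite -fx.
move=> /(independent_nonneighbours_iso (graph_iso_sym fP)); rewrite fK.
by move=> /labelled_not_independent.
Qed.

Lemma pendant_inr A v i : i < label v -> pendant (labelled_adj A) (inr (v, i)).
Proof. by move=> iv; exists (inl v) => // -[w|//] [->]. Qed.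

Lemma incidence_not_pendant A v : ~ pendant (labelled_adj A) (inl v).
Proof.
move=> [y _ yP]; have l1 := label_gt1 v.
have := yP (inr (v, 1)) (conj erefl l1).
by rewrite -(yP (inr (v, 0)) (conj erefl (ltnW l1))).
Qed.

Lemma incidence_has_pendant A v : has_pendant (labelled_adj A) (inl v).
Proof.
have l0 := ltnW (label_gt1 v).
by exists (inr (v, 0)); [exact: pendant_inr|split].
Qed.

Lemma inr_no_pendant A p : ~ has_pendant (labelled_adj A) (inr p).
Proof. by case: p => v i [[w|[w j]]] // /incidence_not_pendant. Qed.

Lemma labelled_iso_incidence A B f g : graph_iso (labelled_adj A) (labelled_adj B) f g ->
  forall v, exists w, f (inl v) = inl w.
Proof.
move=> fP v; have := has_pendant_iso fP (incidence_has_pendant A v).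
by case: (f _) => [w|p /inr_no_pendant//]; exists w.
Qed.

(** The pendants of [v] are sent injectively to pendants of [w]; the inverse isomorphism gives the
    other inequality. *)
Lemma labelled_iso_label A B f g v w :
  graph_iso (labelled_adj A) (labelled_adj B) f g ->
  f (inl v) = inl w -> label v <= label w.
Proof.
move=> fP fv; have [fK gK fE gE] := fP.
have /choice[h hP] : forall i : 'I_(label v), exists j : 'I_(label w),
    f (inr (v, val i)) = inr (w, val j).
  move=> i; have := fE (inl v) (inr (v, val i)) (conj erefl (ltn_ord i)).
  rewrite fv; case fi: (f _) => [w'|[w' j]] /=.
    have [v' gw'] := labelled_iso_incidence (graph_iso_sym fP) w'.
    by have := fK (inr (v, val i)); rewrite fi gw'.
  by move=> [<- jw]; exists (Ordinal jw).
rewrite -[label v]card_ord -[label w]card_ord; apply: (leq_card h) => i j hij.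
apply: val_inj; have : f (inr (v, val i)) = f (inr (v, val j)) by rewrite !hP hij.
by move=> /(can_inj fK)[].
Qed.

Lemma onth_map_eq (T T' : Type) (h : T -> T') s s' : size s' = size s ->
  (forall k x, onth s k = Some x -> onth s' k = Some (h x)) -> map h s = s'.
Proof.
elim: s s' => [|x s IH] [|y s'] //= [ss'] sk.
have [->] := sk 0 x erefl; congr cons; apply: IH => // k.
exact: (sk k.+1).
Qed.

(** Labels fix the kind, symbol and arity of each vertex. The edges from a hub to its links keep
    these on one atom, the edges from links to elements show that its arguments are moved by [h],
    and the edge from hub to mark transports truth. *)
Lemma incidence_iso_recover A B f g :
  graph_iso (incidence_adj A) (incidence_adj B) f g ->
  (forall v, label (f v) = label v) ->
  exists2 h : K -> K, (forall x, f (inl x) = inl (h x)) &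
    forall i s, atom_true A i s -> atom_true B i (map h s).
Proof.
move=> [fK gK fE gE] fL.
have /choice[h hP] : forall x, exists y, f (inl x) = inl y.
  move=> x; have := fL (inl x); case: (f _) => [y _|[[i s] j]//].
  by exists y.
have fR i s j : exists2 s', f (inr (i, s, j)) = inr (i, s', j) & size s' = size s.
  have := fL (inr (i, s, j)); case: (f _) => [//|[[i' s'] j']] /=.
  by move=> [/(pcan_inj choice.pickleK)[-> ss ->]]; exists s'.
exists h => // i s sA; have [s' s'E ss'] := fR i s 0.
have -> : map h s = s'.
  have sk k x : onth s k = Some x -> onth s' k = Some (h x).
    move=> skx; have [r rE _] := fR i s k.+2.
    have := fE (inr (i, s, 0)) (inr (i, s, k.+2)) (or_introl erefl).
    rewrite s'E rE => -[/= [s'r]|//]; rewrite -s'r in rE.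
    by have := fE (inl x) (inr (i, s, k.+2)) (or_introl skx); rewrite hP rE => -[].
  exact: onth_map_eq.
have [r rE _] := fR i s 1.
have := fE (inr (i, s, 0)) (inr (i, s, 1)) (or_introl (conj erefl sA)).
by rewrite s'E rE => -[/= [_ ?]|].
Qed.

Theorem code_iso_recover A B f g :
  graph_iso (code_adj A) (code_adj B) f g ->
  isomorphic (Structure A) (Structure B).
Proof.
move=> fP; have [|||f1 [g1 [fP1 _ _]]] := graph_iso_restrict (i := @GenTree.Leaf _) _ fP.
- by move=> x y [].
- exact: code_iso_leaf fP.
- exact: code_iso_leaf (graph_iso_sym fP).
have [|||f2 [g2 [fP2 _ _]]] := graph_iso_restrict (i := inr) _ fP1.
- by move=> x y [].
- exact: core_iso_labelled fP1.
- exact: core_iso_labelled (graph_iso_sym fP1).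
have [|||f3 [g3 [fP3 f3E g3E]]] := graph_iso_restrict (i := inl) _ fP2.
- by move=> x y [].
- exact: labelled_iso_incidence fP2.
- exact: labelled_iso_incidence (graph_iso_sym fP2).
have [fK gK _ _] := fP3.
have fL v : label (f3 v) = label v.
  apply/eqP; rewrite eqn_leq (labelled_iso_label fP2 (f3E v)) andbT.
  by apply: (labelled_iso_label (graph_iso_sym fP2)); rewrite g3E fK.
have gL v : label (g3 v) = label v by rewrite -{2}[v]gK fL.
have [h hE hP] := incidence_iso_recover fP3 fL.
have [k kE kP] := incidence_iso_recover (graph_iso_sym fP3) gL.
have hK : cancel h k by move=> x; have := fK (inl x); rewrite hE kE => -[].
have kK : cancel k h by move=> x; have := gK (inl x); rewrite kE hE => -[].
exists h; first by exists k.
move=> [n i] t; rewrite [X in X <-> _](atom_trueP A) [X in _ <-> X](atom_trueP B).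
by split=> [/hP//|/kP]; rewrite /= (mapK hK).
Qed.

End Recover.

(** * Small types *)

Section Small.
Variables (d : Order.disp_t) (K : orderType d).

Definition small (T : Type) : Prop := exists f : T -> K, injective f.

Lemma small_inj (T U : Type) (f : T -> U) : injective f -> small U -> small T.
Proof. by move=> f_inj [g g_inj]; exists (g \o f); exact: inj_comp. Qed.

Lemma small_self : small K. Proof. by exists id. Qed.

Lemma small_segment (a : K) : small (segment a).
Proof. by exists sval => -[x xa] [y ya] /= xy; exact: eq_exist. Qed.

Hypothesis K_uncountable : ~ countable [set: K].

Lemma uncountable_inhabited : exists k : K, True.
Proof.
apply: contrapT => nK; apply: K_uncountable.
suff -> : [set: K] = set0 by [].
by apply/seteqP; split=> // k _; apply: nK; exists k.
Qed.

Hypothesis K_seq : small (seq K).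

Lemma small_seq (T : Type) : small T -> small (seq T).
Proof.
by move=> [f f_inj]; apply: (small_inj (f := map f)) K_seq; exact: inj_map.
Qed.

Lemma small_nat : small nat.
Proof.
have [k _] := uncountable_inhabited; apply: (small_inj (f := nseq^~ k)) K_seq.
by move=> m n /(congr1 size); rewrite !size_nseq.
Qed.

Lemma small_prod (T U : Type) : small T -> small U -> small (T * U).
Proof.
move=> [f f_inj] [g g_inj].
apply: (small_inj (f := fun p => [:: f p.1; g p.2])) K_seq.
by move=> [x y] [x' y'] /= [/f_inj-> /g_inj->].
Qed.

Lemma small_sum (T U : Type) : small T -> small U -> small (T + U).
Proof.
move=> [f f_inj] [g g_inj].
apply: (small_inj (f := fun x => match x with
  inl x => [:: f x] | inr y => [:: g y; g y] end)) K_seq.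
by move=> [x|y] [x'|y'] //= [] => [/f_inj->|/g_inj->].
Qed.

Lemma small_bool : small bool.
Proof. by apply: (small_inj (f := nat_of_bool)) small_nat => -[] []. Qed.

Lemma small_option (T : Type) : small T -> small (option T).
Proof.
move=> sT; apply: (small_inj (f := fun o : option T =>
  if o is Some x then inl x else inr true)) (small_sum sT small_bool).
by move=> [x|] [y|] //= [->].
Qed.

Lemma small_tree (T : Type) : small T -> small (GenTree.tree T).
Proof.
move=> sT; apply: (small_inj (f := @GenTree.encode T)).
  exact: pcan_inj (GenTree.codeK T).
exact/small_seq/small_sum/sT/small_nat.
Qed.

(** A maximal [a] would make its segment all of [K] but one point, and an infinite set injects into
    itself minus a point. *)
Lemma no_max : is_cardinal K -> forall a : K, exists b, (a < b)%O.
Proof.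
move=> [_ Kseg] a; apply: contrapT => amax; apply: (Kseg a).
have [j j_inj] := small_option small_self.
(* The point [j None] is missed by [j \o Some]; exchanging it with [a] makes [a] the missed
   point. *)
pose s x := if x == j None then a else if x == a then j None else x.
have s_inj : injective s.
  move=> x y; rewrite /s; case: (x =P j None) => [->|xN];
    case: (y =P j None) => [->|yN] //; case: (x =P a) => [xa|xa];
    case: (y =P a) => [ya|ya] //; try congruence.
have lt_a x : (s (j (Some x)) < a)%O.
  have neq : s (j (Some x)) <> a.
    rewrite -(_ : s (j None) = a); last by rewrite /s eqxx.
    by move=> /s_inj/j_inj.
  case: (ltgtP (s (j (Some x))) a) => // lt_a; case: amax.
  by exists (s (j (Some x))).
pose h x : segment a := exist _ (s (j (Some x))) (lt_a x).
have /injfunPex[f] : exists2 f : K -> segment a, set_fun [set: K] [set: segment a] f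
    & set_inj [set: K] f.
  exists h => // x y _ _ /(congr1 sval)/= /s_inj/j_inj.
  by case.
exact: inj_card_le f.
Qed.

Lemma small_short_seq : [set: short_seq K K] #= [set: K] ->
  small (short_seq K bool).
Proof.
move=> KK; have [h h_inj] := small_bool.
have hK : exists h', cancel h h'.
  exists (fun k => `[< k = h true >]) => b; apply/asboolP/idP => [/h_inj->//|].
  by case: b.
have [h' h'K] := hK.
pose f (p : short_seq K bool) : short_seq K K :=
  existT _ (projT1 p) (fun x => h (projT2 p x)).
pose g (p : short_seq K K) : short_seq K bool :=
  existT _ (projT1 p) (fun x => h' (projT2 p x)).
apply: (small_inj (f := f)).
  apply: (can_inj (g := g)) => -[a p]; rewrite /g /f /=; congr existT.
  by apply/funext => x; rewrite h'K.
have : [set: short_seq K K] #<= [set: K] by rewrite card_eq_le in KK; case/andP: KK.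
by move=> /card_le_inj[e e_inj _]; exists e.
Qed.

End Small.

(** * Borel predicates *)

Section BorelPredicates.
Variables (d : Order.disp_t) (K : orderType d).
Local Notation small := (small K).

Definition borel_pred (P : gcantor K -> Prop) : Prop := borel [set eta | P eta].

Lemma borel_pred_ext (P Q : gcantor K -> Prop) :
  (forall eta, P eta <-> Q eta) -> borel_pred P -> borel_pred Q.
Proof.
by move=> PQ; rewrite /borel_pred; congr borel; apply/seteqP; split=> eta /PQ.
Qed.

Lemma borel_pred_cst (p : Prop) : borel_pred (fun=> p).
Proof.
case: (pselect p) => hp.
  by apply: (@borel_pred_ext (fun=> True)) => //; apply: borel_open; exact: openT.
by apply: (@borel_pred_ext (fun=> False)) => //; apply: borel_open; exact: open0.
Qed.

Lemma borel_pred_not P : borel_pred P -> borel_pred (fun eta => ~ P eta).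
Proof. exact: borel_setC. Qed.

(** The union is reindexed by [K] along the injection; indices outside its range contribute the
    empty set. *)
Lemma borel_pred_exists (T : Type) (P : T -> gcantor K -> Prop) : small T ->
  (forall t, borel_pred (P t)) -> borel_pred (fun eta => exists t, P t eta).
Proof.
move=> [f f_inj] PB.
apply: (@borel_pred_ext (fun eta => exists k, exists2 t, f t = k & P t eta)).
  by move=> eta; split=> [[k [t _ tP]]|[t tP]]; [exists t|exists (f t), t].
rewrite /borel_pred.
have -> : [set eta | exists k, exists2 t, f t = k & P t eta] =
    \bigcup_k [set eta | exists2 t, f t = k & P t eta].
  by apply/seteqP; split=> eta [k]; [exists k|exists k].
apply: borel_bigcup => k; case: (pselect (exists t, f t = k)) => [[t tk]|nt].
  apply: borel_pred_ext (PB t) => eta; split; first by exists t.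
  by move=> [t' t'k]; rewrite -tk in t'k; rewrite (f_inj _ _ t'k).
apply: borel_pred_ext (borel_pred_cst False) => eta; split=> // -[t tk _].
by apply: nt; exists t.
Qed.

Lemma borel_pred_forall (T : Type) (P : T -> gcantor K -> Prop) : small T ->
  (forall t, borel_pred (P t)) -> borel_pred (fun eta => forall t, P t eta).
Proof.
move=> sT PB; apply: (@borel_pred_ext (fun eta => ~ exists t, ~ P t eta)).
  move=> eta; split=> [nP t|tP [t]]; last by apply; exact: tP.
  by apply: contrapT => nt; apply: nP; exists t.
by apply/borel_pred_not/borel_pred_exists => // t; exact: borel_pred_not.
Qed.

Hypothesis K_bool : small bool.

Lemma borel_pred_or P Q : borel_pred P -> borel_pred Q ->
  borel_pred (fun eta => P eta \/ Q eta).
Proof.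
move=> PB QB.
apply: (@borel_pred_ext (fun eta => exists b : bool, if b then P eta else Q eta)).
  by move=> eta; split=> [[[]]|[]]; [left|right|exists true|exists false].
by apply: borel_pred_exists => // -[].
Qed.

Lemma borel_pred_and P Q : borel_pred P -> borel_pred Q ->
  borel_pred (fun eta => P eta /\ Q eta).
Proof.
move=> PB QB.
apply: (@borel_pred_ext (fun eta => forall b : bool, if b then P eta else Q eta)).
  by move=> eta; split=> [h|[? ?] []//]; split; [exact: (h true)|exact: (h false)].
by apply: borel_pred_forall => // -[].
Qed.

Lemma borel_pred_imp P Q : borel_pred P -> borel_pred Q ->
  borel_pred (fun eta => P eta -> Q eta).
Proof.
move=> PB QB; apply: (@borel_pred_ext (fun eta => ~ P eta \/ Q eta)).
  move=> eta; split=> [[nP /nP//|q _//]|pq].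
  by case: (pselect (P eta)) => [/pq|]; [right|left].
by apply: borel_pred_or => //; exact: borel_pred_not.
Qed.

Lemma open_cylinder (p : short_seq K bool) : open (cylinder p).
Proof.
exists [set cylinder p]; last by rewrite bigcup_set1.
move=> _ ->; exists [fset cylinder p]%fset; last by rewrite set_fset1 bigcap_set1.
by move=> C; rewrite in_fset1 => /eqP ->; rewrite inE; exists p.
Qed.

Lemma open_from_cylinders (U : set (gcantor K)) : open U ->
  exists2 D : set (set (gcantor K)),
    (forall C, D C -> finI_from (range (@cylinder d K)) id C) &
    \bigcup_(C in D) C = U.
Proof. by move=> [D DP <-]; exists D. Qed.

(** Basic open sets are finite intersections of cylinders, and the restriction of [eta] to the
    largest of their lengths determines a cylinder inside all of them. The length [k0] is a default
    for the empty intersection. *)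
Lemma open_cylinderP (U : set (gcantor K)) eta (k0 : K) : open U -> U eta ->
  exists2 p, cylinder p eta & cylinder p `<=` U.
Proof.
move=> /open_from_cylinders[D DP <-] [C DC Ceta]; have [F FP FC] := DP C DC.
pose cyl a : short_seq K bool := existT _ a (fun x : segment a => eta (sval x)).
suff [a aP] : exists a, forall c, c \in F -> cylinder (cyl a) `<=` c.
  exists (cyl a) => // xi xiP; exists C => //; rewrite -FC => c cF.
  exact: aP cF _ xiP.
have {}Ceta c : c \in F -> c eta by move=> cF; rewrite -FC in Ceta; exact: Ceta.
have {FP FC DC DP}: forall c, c \in (F : seq _) -> exists p, c = cylinder p.
  by move=> c /FP; rewrite inE => -[p _ <-]; exists p.
move: Ceta; rewrite -[forall c, c \in F -> c eta]/(forall c, c \in (F : seq _) -> c eta).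
rewrite -[X in _ -> _ -> X]/(exists a, forall c, c \in (F : seq _) -> _).
elim: (F : seq _) => [|c s IH] Ceta cyls; first by exists k0.
have [||a aP] := IH; first by move=> e es; apply: Ceta; rewrite inE es orbT.
  by move=> e es; apply: cyls; rewrite inE es orbT.
have [[b p] cE] := cyls c (mem_head _ _).
have ceta := Ceta c (mem_head _ _).
exists (Order.max a b) => e; rewrite inE => /orP[/eqP->|es].
  rewrite cE => xi xiP x; rewrite cE in ceta; rewrite -(ceta x).
  have xab : (sval x < Order.max a b)%O by rewrite lt_max (svalP x) orbT.
  exact: (xiP (exist _ (sval x) xab)).
apply: subset_trans (aP e es) => xi xiP x.
have xab : (sval x < Order.max a b)%O by rewrite lt_max (svalP x).
exact: (xiP (exist _ (sval x) xab)).
Qed.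

(** An open set is the union of the cylinders that it contains, at most [K] many, and membership in
    a cylinder is a conjunction of at most [K] conditions on single bits. *)
Lemma borel_pred_fun (F : gcantor K -> gcantor K) (k0 : K) :
  small (short_seq K bool) -> (forall k, borel_pred (fun eta => F eta k)) ->
  borel_fun F.
Proof.
move=> sK FB U oU; suff : borel_pred (fun eta => U (F eta)) by [].
apply: (@borel_pred_ext (fun eta => exists p, cylinder p `<=` U /\
    forall x : segment (projT1 p), F eta (sval x) = projT2 p x)).
  move=> eta; split=> [[p [pU pF]]|/(open_cylinderP k0 oU)[p pF pU]].
    exact: pU.
  by exists p.
apply: borel_pred_exists => // p; apply: borel_pred_and; first exact: borel_pred_cst.
apply: borel_pred_forall; first exact: small_segment.
move=> x; case: (projT2 p x); first exact: FB.
by apply: borel_pred_ext (borel_pred_not (FB (sval x))) => eta; split=> [/negP/negbTE|->].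
Qed.

Lemma borel_pred_bit (k : K) : (exists b, (k < b)%O) -> small (short_seq K bool) ->
  borel_pred (fun eta => eta k).
Proof.
move=> [b kb] sK.
apply: (@borel_pred_ext (fun eta => exists p : short_seq K bool, cylinder p eta /\
    exists x, sval x = k /\ projT2 p x)).
  move=> eta; split=> [[p [pe [x [<- px]]]]|ek]; first by rewrite pe.
  exists (existT _ b (fun x : segment b => eta (sval x))); split=> //.
  by exists (exist _ k kb).
apply: borel_pred_exists => // p; apply: borel_pred_and; last exact: borel_pred_cst.
exact/borel_open/open_cylinder.
Qed.

End BorelPredicates.

(** * Quotients with universe K *)

Section QuotientOnK.
Variables (d : Order.disp_t) (K : orderType d) (W : Type) (iota : W -> K).
Variables (eqv : W -> W -> Prop) (e : K -> W).

(* [is_rep] chooses in each class the word of least code, and [eqv_value]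
   composes this injection of the quotient into K with the Cantor-Bernstein
   bijection, [e] being an injection of K into the quotient; everything is
   explicit so as to depend on [eqv] in a Borel way. *)
Definition is_rep w k :=
  (exists w', iota w' = k /\ eqv w' w) /\ (forall w', eqv w' w -> ~ (iota w' < k)%O).

(** The Cantor-Bernstein orbits: points of [K] reached from non-representatives by iterating the map
    from [k] to the representative of [e k]. On these points [shifted] applies that map, and
    elsewhere it is the identity. *)
Fixpoint from_nonrep n k : Prop :=
  match n with
  | 0 => ~ exists w, is_rep w k
  | m.+1 => exists k', from_nonrep m k' /\ is_rep (e k') k
  end.

Definition shifted k k' :=
  ((exists n, from_nonrep n k) /\ is_rep (e k) k') \/
  (~ (exists n, from_nonrep n k) /\ k = k').

Definition eqv_value w k := exists k', is_rep w k' /\ shifted k k'.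

Hypothesis K_wf : well_founded (fun x y : K => (x < y)%O).
Hypothesis iota_inj : injective iota.
Hypothesis eqv_refl : forall w, eqv w w.
Hypothesis eqv_sym : forall w w', eqv w w' -> eqv w' w.
Hypothesis eqv_trans : forall w w' w'', eqv w w' -> eqv w' w'' -> eqv w w''.
Hypothesis e_inj : forall k k', eqv (e k) (e k') -> k = k'.

Lemma is_rep_fun w k k' : is_rep w k -> is_rep w k' -> k = k'.
Proof.
move=> [[u [uk uw]] kmin] [[u' [uk' uw']] kmin'].
have := kmin _ uw'; have := kmin' _ uw; rewrite uk uk' => /negP + /negP.
by rewrite -!leNgt => le1 le2; apply: le_anti; rewrite le1 le2.
Qed.

Lemma is_rep_total w : exists k, is_rep w k.
Proof.
suff H k : forall w', eqv w' w -> iota w' = k -> exists k, is_rep w k.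
  exact: H (eqv_refl w) erefl.
elim/(well_founded_ind K_wf): k => k IH w' ww' wk.
case: (pselect (exists2 w'', eqv w'' w & (iota w'' < k)%O)) => [[w'' ww'' lt]|nlt].
  exact: IH lt _ ww'' erefl.
exists k; split; first by exists w'.
by move=> w'' ww'' lt; apply: nlt; exists w''.
Qed.

Lemma is_rep_eqv w w' k : is_rep w k -> is_rep w' k -> eqv w w'.
Proof.
move=> [[u [uk uw]] _] [[u' [uk' uw']] _]; apply: eqv_trans (eqv_sym uw) _.
by rewrite (_ : u = u')//; apply: iota_inj; rewrite uk uk'.
Qed.

Lemma eqv_is_rep w w' k : eqv w w' -> is_rep w k -> is_rep w' k.
Proof.
move=> ww' [[u [uk uw]] kmin]; split; first by exists u; split=> //; exact: eqv_trans ww'.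
by move=> v vw'; apply: kmin; exact: eqv_trans vw' (eqv_sym ww').
Qed.

Lemma shifted_total k : exists k', shifted k k'.
Proof.
case: (pselect (exists n, from_nonrep n k)) => kC; last by exists k; right.
by have [k' kk'] := is_rep_total (e k); exists k'; left.
Qed.

Lemma shifted_rep k k' : shifted k k' -> exists w, is_rep w k'.
Proof.
move=> [[_ kk']|[kC <-]]; first by exists (e k).
by apply: contrapT => nk; apply: kC; exists 0.
Qed.

Lemma shifted_inj k1 k2 k : shifted k1 k -> shifted k2 k -> k1 = k2.
Proof.
have mixed a b c : (exists n, from_nonrep n a) -> is_rep (e a) c ->
    ~ (exists n, from_nonrep n b) -> b = c -> False.
  by move=> [n an] ac bC bc; apply: bC; exists n.+1, a; rewrite bc.
move=> [[C1 r1]|[C1 r1]] [[C2 r2]|[C2 r2]].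
- exact/e_inj/(is_rep_eqv r1 r2).
- by case: (mixed _ _ _ C1 r1 C2 r2).
- by case: (mixed _ _ _ C2 r2 C1 r1).
- by rewrite r1 r2.
Qed.

Lemma shifted_onto w k : is_rep w k -> exists k', shifted k' k.
Proof.
move=> wk; case: (pselect (exists n, from_nonrep n k)) => [[[|n]] kC|kC].
- by case: kC; exists w.
- by case: kC => k' [k'n k'k]; exists k'; left; split=> //; exists n.
- by exists k; right.
Qed.

Lemma quotient_on_K : exists ev : W -> K,
  [/\ forall w k, ev w = k <-> eqv_value w k, forall k, exists w, ev w = k
    & forall w w', ev w = ev w' <-> eqv w w'].
Proof.
have tot w : exists k, eqv_value w k.
  by have [k wk] := is_rep_total w; have [k' kk'] := shifted_onto wk; exists k', k.
have func w k k' : eqv_value w k -> eqv_value w k' -> k = k'.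
  move=> [a [wa ka]] [b [wb kb]]; apply: shifted_inj ka _.
  by rewrite (is_rep_fun wa wb).
have shifted_fun k a b : shifted k a -> shifted k b -> a = b.
  by move=> [[C1 r1]|[C1 r1]] [[C2 r2]|[C2 r2]] //; [exact: is_rep_fun r1 r2|rewrite -r1].
have [ev evP] := choice tot; have evE w k : ev w = k <-> eqv_value w k.
  by split=> [<-//|]; exact: func (evP w).
exists ev; split=> // [k|w w'].
  have [k' kk'] := shifted_total k; have [w wk'] := shifted_rep kk'.
  by exists w; apply/evE; exists k'.
split=> [/evE [k [wk s1]]|ww'].
  have [k' [wk' s2]] := evP w'.
  by apply: is_rep_eqv wk _; rewrite (shifted_fun _ _ _ s1 s2).
apply/evE; have [k [wk s]] := evP w'; exists k; split=> //.
exact: eqv_is_rep (eqv_sym ww') wk.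
Qed.

End QuotientOnK.

(** * Borel families of right-angled Coxeter groups *)

Section WordChains.
Variables (S : Type) (P : S -> S -> Prop).

Definition word_step (u v : word S) : Prop := exists u0 v0 r,
  ((exists s b, r = [:: (s, b); (s, ~~ b)]) \/ racg_relators P r) /\
  (u = u0 ++ r ++ v0 /\ v = u0 ++ v0).

Fixpoint word_chain n u v : Prop :=
  match n with
  | 0 => u = v
  | m.+1 => exists w, (word_step u w \/ word_step w u) /\ word_chain m w v
  end.

Lemma word_chain_cat m n u v w :
  word_chain m u v -> word_chain n v w -> word_chain (m + n) u w.
Proof.
elim: m u => [|m IH] u /=; first by move=> ->.
by move=> [x [ux xv]] vw; exists x; split=> //; exact: IH.
Qed.

Lemma word_chain_sym n u v : word_chain n u v -> word_chain n v u.
Proof.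
elim: n u v => [|n IH] u v // [w [uw /IH wv]]; rewrite -addn1.
by apply: word_chain_cat wv _; exists u; split=> //; case: uw; [right|left].
Qed.

(** Derivability becomes a countable union of conditions built from quantifiers over words, a form
    in which it can be shown to be Borel. *)
Lemma racg_eqE u v : racg_eq P u v <-> exists n, word_chain n u v.
Proof.
split=> [|[n]].
  elim=> {u v} [u|u v _ [n uv]|u v w _ [m uv] _ [n vw]|u s b v|u r v rP].
  - by exists 0.
  - by exists n; exact: word_chain_sym.
  - by exists (m + n); exact: word_chain_cat uv vw.
  - exists 1, (u ++ v); split=> //; left; exists u, v, [:: (s, b); (s, ~~ b)].
    by split=> //; left; exists s, b.
  - exists 1, (u ++ v); split=> //; left; exists u, v, r.
    by split=> //; right.
have step x y : word_step x y -> racg_eq P x y.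
  move=> [u0 [v0 [r [[[s [b ->]]|rP] [-> ->]]]]]; first exact: word_eq_cancel.
  exact: word_eq_rel.
elim: n u => [|n IH] u /=; first by move=> ->; exact: word_eq_refl.
move=> [w [uw /IH wv]]; apply: word_eq_trans wv.
by case: uw => /step //; exact: word_eq_sym.
Qed.

End WordChains.

(** Embedding the indexed family of formulas into untyped trees shows that the conjunction over all
    sentences of a theory is a small one. *)
Fixpoint formula_code n (phi : formula Lstar n) : GenTree.tree nat :=
  match phi with
  | fFalse _ => GenTree.Node 0 [::]
  | fEq _ i j => GenTree.Node 1 [:: GenTree.Leaf (val i); GenTree.Leaf (val j)]
  | fRel _ R t => GenTree.Node 2 (GenTree.Leaf R.1 :: GenTree.Leaf R.2 ::
                                  [seq GenTree.Leaf (val i) | i <- t])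
  | fImp _ p q => GenTree.Node 3 [:: formula_code p; formula_code q]
  | fAll _ p => GenTree.Node 4 [:: formula_code p]
  end.

Lemma formula_code_inj n : injective (@formula_code n).
Proof.
move=> phi; elim: phi => {n} [n|n i j|n R t|n p IHp q IHq|n p IHp] psi.
- by destruct psi.
- by destruct psi => //= -[/val_inj-> /val_inj->].
- destruct psi as [| |n R' t'| |] => //= -[E1 E2 E3].
  have RR' : R = R' by case: R R' E1 E2 {t t' E3} => a b [a' b'] /= -> ->.
  subst R'; congr fRel; apply: val_inj.
  by apply: inj_map E3 => x y [/val_inj].
- by destruct psi => //= -[/IHp-> /IHq->].
- by destruct psi => //= -[/IHp->].
Qed.

(** * The Borel reduction *)

Section Reduction.
Variables (d : Order.disp_t) (K : orderType d).
Hypothesis K_cardinal : is_cardinal K.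
Hypothesis K_uncountable : ~ countable [set: K].
Hypothesis K_power : [set: short_seq K K] #= [set: K].
Variable code : atom K -> K.
Hypothesis code_bij : bijective code.

(** A sequence is the argument of an atom of the symbol [(size s, 0)], so the coding of atoms
    already injects sequences into [K]. *)
Lemma small_seqK : small K (seq K).
Proof.
exists (fun s => code (existT _ (size s, 0) (in_tuple s))) => s s'.
by move=> /(bij_inj code_bij)/(congr1 (fun a : atom K => tval (projT2 a))).
Qed.

Let sK : small K K := small_self K.
Let sseq := small_seq small_seqK.
Let snat := small_nat K_uncountable small_seqK.
Let sbool := small_bool K_uncountable small_seqK.
Let sprod := small_prod small_seqK.
Let ssum := small_sum small_seqK.
Let sshort := small_short_seq K_uncountable small_seqK K_power.

Lemma small_code_vertex : small K (code_vertex K).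
Proof.
apply: small_tree => //; first exact: small_seqK.
have sinc : small K (incidence_vertex K).
  by apply: ssum => //; apply/sprod/snat/sprod/sseq.
by apply: ssum => //; apply: ssum => //; exact: sprod.
Qed.

Lemma small_word : small K (word (code_vertex K)).
Proof. exact/sseq/sprod/sbool/small_code_vertex. Qed.

Definition decode (eta : gcantor K) : interpretation Lstar K :=
  fun R => [set t | eta (code (existT _ R t))].

Lemma decodeK eta : eta_code code (decode eta) = eta.
Proof.
apply/funext => k; apply/asboolP/idP => [[R [t [-> //]]]|ek].
have [b _ bK] := code_bij; case ba: (b k) => [R t]; exists R, t.
have kE : k = code (existT _ R t) by rewrite -ba bK.
by split=> //; rewrite /decode /= -kE.
Qed.

Lemma eta_codeE (A : interpretation Lstar K) R t :
  eta_code code A (code (existT _ R t)) <-> A R t.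
Proof.
split=> [/asboolP[R' [t' [/(bij_inj code_bij) E AR]]]|AR].
  suff : forall a a' : atom K, a = a' ->
      A (projT1 a') (projT2 a') -> A (projT1 a) (projT2 a).
    by move=> /(_ _ _ E AR).
  by move=> a a' ->.
by apply/asboolP; exists R, t.
Qed.

Lemma eta_codeK (A : interpretation Lstar K) : decode (eta_code code A) = A.
Proof.
by apply: functional_extensionality_dep => R; apply/seteqP; split=> t /eta_codeE.
Qed.

Lemma iso_relE T eta xi : iso_rel code T eta xi <->
  [/\ models (Structure (decode eta)) T, models (Structure (decode xi)) T &
      isomorphic (Structure (decode eta)) (Structure (decode xi))] \/
  (~ models (Structure (decode eta)) T /\ ~ models (Structure (decode xi)) T).
Proof.
split=> [[A [B [-> -> H]]]|H]; first by rewrite !eta_codeK.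
by exists (decode eta), (decode xi); rewrite !decodeK.
Qed.

Local Notation bpred := (@borel_pred d K).

Lemma borel_bit R (t : (arity R).-tuple K) : bpred (fun eta => decode eta t).
Proof.
by apply: borel_pred_bit => //; exact: (no_max K_uncountable small_seqK K_cardinal).
Qed.

Lemma borel_sat n (phi : formula Lstar n) (v : 'I_n -> K) :
  bpred (fun eta => sat (M := Structure (decode eta)) phi v).
Proof.
elim: phi v => {n} [n|n i j|n R t|n p IHp q IHq|n p IHp] v /=.
- exact: borel_pred_cst.
- exact: borel_pred_cst.
- exact: borel_bit.
- exact: (borel_pred_imp sbool).
- by apply: borel_pred_forall.
Qed.

Lemma borel_models T : bpred (fun eta => models (Structure (decode eta)) T).
Proof.
apply: borel_pred_forall => [|phi].
  apply: (small_inj (@formula_code_inj 0)); apply: small_tree => //.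
  exact: small_seqK.
apply: (borel_pred_imp sbool); first exact: borel_pred_cst.
exact: (borel_sat phi (@empty_env K)).
Qed.

Definition gadj (eta : gcantor K) := code_adj (decode eta).

Lemma borel_gadj t u : bpred (fun eta => gadj eta t u).
Proof.
rewrite /gadj; case: t u => [x|n ts] [y|m us]; try exact: borel_pred_cst.
have inc v w : bpred (fun eta => incident (decode eta) v w).
  (* Only the edge from a hub to its mark depends on [eta]. *)
  case: v w => [z|[[i s] [|[|j]]]] [z'|[[i' s'] [|[|j']]]]; try exact: borel_pred_cst.
  by apply: (borel_pred_and sbool); [exact: borel_pred_cst|exact: borel_bit].
case: x y => [x|[v|[v i]]] [y|[w|[w j]]]; try exact: borel_pred_cst.
exact: (borel_pred_or sbool).
Qed.

Lemma borel_racg_eq u v : bpred (fun eta => racg_eq (gadj eta) u v).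
Proof.
have rel r : bpred (fun eta => racg_relators (gadj eta) r).
  apply: (borel_pred_or sbool); first exact: borel_pred_cst.
  apply: borel_pred_exists => [|s]; first exact: small_code_vertex.
  apply: borel_pred_exists => [|s']; first exact: small_code_vertex.
  apply: (@borel_pred_ext _ _ (fun eta => gadj eta s s' /\ (s <> s' /\
    r = [:: (s, true); (s', true); (s, true); (s', true)]))).
    by move=> eta; split=> [[? []]|[]].
  by apply: (borel_pred_and sbool); [exact: borel_gadj|exact: borel_pred_cst].
have step x y : bpred (fun eta => word_step (gadj eta) x y).
  apply: borel_pred_exists => [|u0]; first exact: small_word.
  apply: borel_pred_exists => [|v0]; first exact: small_word.
  apply: borel_pred_exists => [|r]; first exact: small_word.
  apply: (borel_pred_and sbool); last exact: borel_pred_cst.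
  by apply: (borel_pred_or sbool); first exact: borel_pred_cst.
have chain n x y : bpred (fun eta => word_chain (gadj eta) n x y).
  elim: n x => [|n IH] x; first exact: borel_pred_cst.
  apply: borel_pred_exists => [|w]; first exact: small_word.
  by apply: (borel_pred_and sbool) => //; exact: (borel_pred_or sbool).
apply: (@borel_pred_ext _ _ (fun eta => exists n, word_chain (gadj eta) n u v)).
  by move=> eta; rewrite racg_eqE.
exact: borel_pred_exists.
Qed.

Variable iota : word (code_vertex K) -> K.
Hypothesis iota_inj : injective iota.

(** The injection of [K] into the group for Cantor-Bernstein. It uses the independent set of the
    core, and so does not depend on [eta]. *)
Definition letter (k : K) : word (code_vertex K) := [:: (GenTree.Leaf (inl k), true)].

Definition value (eta : gcantor K) := eqv_value iota (racg_eq (gadj eta)) letter.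

Lemma borel_value u k : bpred (fun eta => value eta u k).
Proof.
have rep w a : bpred (fun eta => is_rep iota (racg_eq (gadj eta)) w a).
  apply: (borel_pred_and sbool).
    apply: borel_pred_exists => [|w']; first exact: small_word.
    by apply: (borel_pred_and sbool); [exact: borel_pred_cst|exact: borel_racg_eq].
  apply: borel_pred_forall => [|w']; first exact: small_word.
  by apply: (borel_pred_imp sbool); [exact: borel_racg_eq|exact: borel_pred_cst].
have from a : bpred (fun eta =>
    exists n, from_nonrep iota (racg_eq (gadj eta)) letter n a).
  apply: borel_pred_exists => // n; elim: n a => [|n IH] a.
    by apply/borel_pred_not/borel_pred_exists => //; exact: small_word.
  by apply: borel_pred_exists => // a'; exact: (borel_pred_and sbool).
apply: borel_pred_exists => // k'; apply: (borel_pred_and sbool) => //.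
apply: (borel_pred_or sbool); apply: (borel_pred_and sbool) => //.
  exact: borel_pred_not.
exact: borel_pred_cst.
Qed.

Fixpoint values (eta : gcantor K) (us : seq (word (code_vertex K))) (ks : seq K) :=
  match us, ks with
  | [::], [::] => True
  | u :: us', k :: ks' => value eta u k /\ values eta us' ks'
  | _, _ => False
  end.

Definition racg_of (eta : gcantor K) : interpretation Lstar K :=
  fun R => [set t | exists us,
    values eta us (tval t) /\ racg_atom (gadj eta) R.2 us].

Lemma borel_racg_of R (t : (arity R).-tuple K) : bpred (fun eta => racg_of eta t).
Proof.
apply: borel_pred_exists => [|us]; first exact/sseq/small_word.
apply: (borel_pred_and sbool).
  elim: us (tval t) => [|u us IH] [|k ks]; try exact: borel_pred_cst.
  by apply: (borel_pred_and sbool) => //; exact: borel_value.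
case: R.2 => [|i]; last exact: borel_pred_cst.
by case: us => [|u [|v [|w [|? ?]]]]; try exact: borel_pred_cst; exact: borel_racg_eq.
Qed.

Lemma racg_of_presented eta : exists ev : word (code_vertex K) -> K,
  presented (M := Structure (racg_of eta)) (gadj eta) ev.
Proof.
have letter_inj k k' : racg_eq (gadj eta) (letter k) (letter k') -> k = k'.
  move=> /(par_eq (GenTree.Leaf (inl k))).
  by rewrite !par_letter eqxx => /esym/eqP[].
have [ev [evE surj evP]] := quotient_on_K (proj1 K_cardinal) iota_inj
  (@word_eq_refl _ _) (@word_eq_sym _ _) (@word_eq_trans _ _) letter_inj.
exists ev; split=> // R t.
have valuesE us ks : values eta us ks <-> map ev us = ks.
  elim: us ks => [|u us IH] [|k ks] //=; split=> //.
    by move=> [/evE <- /IH <-].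
  by move=> [uk usk]; split; [apply/evE|apply/IH].
by split=> -[us [/valuesE usE usP]]; exists us.
Qed.

(** Structures that are not models of [T] are sent to the structure with empty relations. This is
    never a model of [T_racg], in which the unit relation is non-empty. *)
Definition reduction (T : theory Lstar) (eta : gcantor K) : gcantor K :=
  eta_code code (fun R => [set t |
    models (Structure (decode eta)) T /\ racg_of eta t]).

Lemma borel_reduction T : borel_fun (reduction T).
Proof.
have [k0 _] := uncountable_inhabited K_uncountable.
apply: (borel_pred_fun sbool k0 sshort) => k.
have [b _ bK] := code_bij; case ba: (b k) => [R t].
have -> : k = code (existT _ R t) by rewrite -ba bK.
apply: (@borel_pred_ext _ _ (fun eta =>
  models (Structure (decode eta)) T /\ racg_of eta t)).
  by move=> eta; rewrite eta_codeE.
by apply: (borel_pred_and sbool); [exact: borel_models|exact: borel_racg_of].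
Qed.

Lemma decode_reduction T eta : models (Structure (decode eta)) T ->
  decode (reduction T eta) = racg_of eta.
Proof.
move=> etaT; rewrite eta_codeK; apply: functional_extensionality_dep => R.
by apply/seteqP; split=> t //= [].
Qed.

Lemma isomorphic_racg_of eta xi :
  isomorphic (Structure (decode eta)) (Structure (decode xi)) <->
  isomorphic (Structure (racg_of eta)) (Structure (racg_of xi)).
Proof.
have [ev evP] := racg_of_presented eta; have [ev' evP'] := racg_of_presented xi.
split=> [/isomorphic_code[f [g fg]]|iso].
  exact: graph_iso_presented evP evP' fg.
have [f [g fg]] : exists f g, graph_iso (gadj eta) (gadj xi) f g.
  apply: isomorphic_graph_iso evP evP' iso => //; try exact: code_adj_sym;
    try exact: code_adj_irr; exact: code_extension.
exact: code_iso_recover fg.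
Qed.

Variable T_racg : theory Lstar.
Hypothesis T_racgP : is_T_racg T_racg.

Lemma racg_of_models eta : models (Structure (racg_of eta)) T_racg.
Proof.
have [W [S [gen [racg rg ->]]]] := T_racgP => phi phiW.
have [ev evP] := racg_of_presented eta.
rewrite -[holds _ _]/(theory_of (Structure (racg_of eta)) phi).
(* The generating type [S] has no given decidable equality, so it is equipped with the classical
   one. *)
rewrite (@presented_theory (code_vertex K) {classic S} (gadj eta) (commuting gen) _ _ _ _
  (Structure (racg_of eta)) (group_structure W) ev (word_eval gen)) //.
- exact: code_adj_sym.
- by move=> s t [st C]; split; [exact: nesym|].
- exact: code_extension.
- exact: (@T_rg_extension_property {classic S}).
- exact: racg_presented.
Qed.

Lemma empty_not_racg (A : interpretation Lstar K) :
  (forall R t, ~ A R t) -> ~ models (Structure A) T_racg.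
Proof.
move=> A0; have [W [S [gen [_ _ ->]]]] := T_racgP => /(_
  (fEx (@fRel Lstar 1 (1, 0) [tuple ord0]))) H.
have : holds (Structure A) (fEx (@fRel Lstar 1 (1, 0) [tuple ord0])).
  by apply: H; apply/sat_fEx; exists 1%g; rewrite /= /env_cons unlift_none.
by rewrite /holds sat_fEx => -[a]; exact: A0.
Qed.

Lemma reduction_models T eta : models (Structure (decode eta)) T <->
  models (Structure (decode (reduction T eta))) T_racg.
Proof.
split=> [etaT|]; first by rewrite decode_reduction//; exact: racg_of_models.
move=> rT; apply: contrapT => etaT; apply: empty_not_racg rT => R t.
by rewrite eta_codeK => -[].
Qed.

Lemma reduction_iso T eta xi : iso_rel code T eta xi <->
  iso_rel code T_racg (reduction T eta) (reduction T xi).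
Proof.
rewrite !iso_relE -!(propext (reduction_models T _)).
split=> -[[eT xT iso]|?]; [left|by right|left|by right]; split=> //.
  by rewrite !decode_reduction//; apply/isomorphic_racg_of.
by apply/isomorphic_racg_of; rewrite !decode_reduction// in iso.
Qed.

End Reduction.

Theorem theorem3p2 (d : Order.disp_t) (K : orderType d)
  (K_cardinal : is_cardinal K)
  (K_uncountable : ~ countable [set: K])
  (K_power : [set: short_seq K K] #= [set: K])
  (code : atom K -> K) (code_bij : bijective code)
  (T : theory Lstar) (T_complete : complete_theory T)
  (T_racg : theory Lstar) (T_racgP : is_T_racg T_racg) :
  borel_reducible (iso_rel code T) (iso_rel code T_racg).
Proof.
have [iota iota_inj] := small_word K_uncountable code_bij.
exists (reduction code iota T); first exact: borel_reduction.
by move=> eta xi; exact: reduction_iso.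
Qed.
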